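(* Let $\gamma:[0,1]\to\mathcal{D}(n)$ be a loop of finite complexity in the space $\mathcal{D}(n)$ of Delzant polytopes in $\mathbb{R}^n$. Then $\gamma$ is null-homotopic in $\mathcal{D}(n)$.
   Context: A Delzant polytope in $\mathbb{R}^n$ is a full-dimensional polytope such that every vertex lies in exactly $n$ edges, all edge directions are rational, and at each vertex the $n$ primitive integer vectors along the edges form a basis of $\mathbb{Z}^n$. $\mathcal{D}(n)$ is the set of Delzant polytopes in $\mathbb{R}^n$ with the topology induced by the Hausdorff distance, equivalently by the symmetric difference distance $\delta^V(P,Q)=\mathrm{Vol}(P\setminus Q)+\mathrm{Vol}(Q\setminus P)$. The normal fan of a polytope $P$ consists of the cones $\{\alpha\in(\mathbb{R}^n)^*:\langle\alpha,p-q\rangle\ge 0\ \forall p\in F,q\in P\}$ for all nonempty faces $F$ of $P$. A path $\gamma:[0,1]\to\mathcal{D}(n)$ (continuous map) has finite complexity if the number of different normal fans of the polytopes $\gamma(t)$, $t\in[0,1]$, is finite (equivalently, the number of different rays appearing in these normal fans is finite). A loop is a path with $\gamma(0)=\gamma(1)$. *)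

(* Defs.v *)
From HB Require Import structures.
From mathcomp Require Import all_boot all_order all_algebra.
From mathcomp Require Import all_classical all_reals all_analysis.
From mathcomp Require Import homotopy.
From mathcomp Require Import ring lra.

Set Implicit Arguments.
Unset Strict Implicit.
Unset Printing Implicit Defensive.

Import Order.TTheory GRing.Theory Num.Theory.
Import numFieldNormedType.Exports.

Local Open Scope classical_set_scope.
Local Open Scope ring_scope.

Section EuclideanHausdorff.
Context {R : realType} {n : nat}.
Implicit Types (x y z : 'rV[R]_n) (A B C : set 'rV[R]_n).

(* The library norm on 'rV[R]_n is the maximum norm. *)
Definition euclid_norm x : R := Num.sqrt (\sum_i x 0 i ^+ 2).

Definition euclid_dist x y : R := euclid_norm (x - y).

Definition point_set_dist x A : R := inf [set euclid_dist x a | a in A].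

Definition hausdorff_dist A B : R :=
  Num.max (sup [set point_set_dist a B | a in A])
          (sup [set point_set_dist b A | b in B]).

Lemma euclid_norm_ge0 x : 0 <= euclid_norm x.
Proof. exact: sqrtr_ge0. Qed.

Lemma sqr_euclid_norm x : euclid_norm x ^+ 2 = \sum_i x 0 i ^+ 2.
Proof. by rewrite sqr_sqrtr// sumr_ge0// => i _; rewrite sqr_ge0. Qed.

Lemma euclid_norm0 : euclid_norm 0 = 0.
Proof.
by rewrite /euclid_norm big1 ?sqrtr0// => i _; rewrite mxE expr0n.
Qed.

Lemma euclid_normN x : euclid_norm (- x) = euclid_norm x.
Proof.
by congr Num.sqrt; apply: eq_bigr => i _; rewrite mxE sqrrN.
Qed.

Lemma normr_coord_le_euclid x i : `|x 0 i| <= euclid_norm x.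
Proof.
rewrite -sqrtr_sqr ler_sqrt; last by apply: sumr_ge0 => j _; rewrite sqr_ge0.
by rewrite (bigD1 i)//= lerDl sumr_ge0// => j _; rewrite sqr_ge0.
Qed.

Lemma normr_le_euclid x : `|x| <= euclid_norm x.
Proof.
rewrite [leLHS]/Num.norm/= mx_normrE; apply/bigmax_leP; split.
  exact: euclid_norm_ge0.
by move=> [i j] _ /=; rewrite (ord1 i) normr_coord_le_euclid.
Qed.

Lemma euclid_cauchy_schwarz x y :
  \sum_i x 0 i * y 0 i <= euclid_norm x * euclid_norm y.
Proof.
set a := euclid_norm x; set b := euclid_norm y.
have a0 : 0 <= a by exact: euclid_norm_ge0.
have b0 : 0 <= b by exact: euclid_norm_ge0.
have zero u v : euclid_norm u = 0 -> \sum_i u 0 i * v 0 i = 0.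
  move=> u0; apply: big1 => i _; have := normr_coord_le_euclid u i.
  by rewrite u0 normr_le0 => /eqP->; rewrite mul0r.
have [aE|aN0] := eqVneq a 0; first by rewrite zero// aE mul0r.
have [bE|bN0] := eqVneq b 0.
  by rewrite bE mulr0 (eq_bigr (fun i => y 0 i * x 0 i)) ?zero// => i _;
    rewrite mulrC.
have ab : 0 < a * b by rewrite mulr_gt0// lt_neqAle eq_sym ?aN0 ?bN0.
have : 0 <= \sum_i (b * x 0 i - a * y 0 i) ^+ 2.
  by rewrite sumr_ge0// => i _; rewrite sqr_ge0.
rewrite (eq_bigr (fun i => b ^+ 2 * x 0 i ^+ 2 + a ^+ 2 * y 0 i ^+ 2
   - (a * b *+ 2) * (x 0 i * y 0 i))); last by move=> i _; ring.
rewrite !big_split/= sumrN -!mulr_sumr -!sqr_euclid_norm -/a -/b.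
set s := \sum_i _; rewrite subr_ge0 => h.
have {}h : (a * b *+ 2) * s <= (a * b *+ 2) * (a * b).
  by apply: (le_trans h); rewrite le_eqVlt; apply/orP; left; apply/eqP; ring.
by rewrite ler_pM2l// in h; rewrite pmulrn_lgt0.
Qed.

Lemma euclid_normD x y : euclid_norm (x + y) <= euclid_norm x + euclid_norm y.
Proof.
rewrite -(ler_pXn2r (_ : (0 < 2)%N))// ?nnegrE ?addr_ge0 ?euclid_norm_ge0//.
rewrite sqr_euclid_norm (eq_bigr (fun i => x 0 i ^+ 2 + y 0 i ^+ 2
   + 2 * (x 0 i * y 0 i))); last by move=> i _; rewrite mxE; ring.
rewrite !big_split/= -mulr_sumr -!sqr_euclid_norm.
have := euclid_cauchy_schwarz x y; nra.
Qed.

Lemma euclid_distxx x : euclid_dist x x = 0.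
Proof. by rewrite /euclid_dist subrr euclid_norm0. Qed.

Lemma euclid_dist_ge0 x y : 0 <= euclid_dist x y.
Proof. exact: euclid_norm_ge0. Qed.

Lemma euclid_distC x y : euclid_dist x y = euclid_dist y x.
Proof. by rewrite /euclid_dist -euclid_normN opprB. Qed.

Lemma euclid_dist_triangle y x z :
  euclid_dist x z <= euclid_dist x y + euclid_dist y z.
Proof.
rewrite /euclid_dist; have -> : x - z = (x - y) + (y - z).
  by rewrite addrA subrK.
exact: euclid_normD.
Qed.

Let dists x A := [set euclid_dist x a | a in A].

Lemma has_lbound_dists x A : has_lbound (dists x A).
Proof. by exists 0 => _ [a _ <-]; exact: euclid_dist_ge0. Qed.

Lemma point_set_dist_le x A a : A a -> point_set_dist x A <= euclid_dist x a.
Proof. by move=> Aa; apply: ge_inf; [exact: has_lbound_dists|exists a]. Qed.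

Lemma point_set_dist_ge0 x A : A !=set0 -> 0 <= point_set_dist x A.
Proof.
move=> [a Aa]; apply: lb_le_inf; first by exists (euclid_dist x a), a.
by move=> _ [b _ <-]; exact: euclid_dist_ge0.
Qed.

Lemma point_set_dist_adherent x A e : A !=set0 -> 0 < e ->
  exists2 a, A a & euclid_dist x a < point_set_dist x A + e.
Proof.
move=> [a Aa] e0.
have [|_ [b Ab <-] h] := @inf_adherent _ (dists x A) _ e0; last by exists b.
by split; [exists (euclid_dist x a), a|exact: has_lbound_dists].
Qed.

Lemma point_set_dist_lipschitz x y A : A !=set0 ->
  point_set_dist x A <= euclid_dist x y + point_set_dist y A.
Proof.
move=> A0; apply/ler_addgt0Pl => e e0.
have [a Aa h] := point_set_dist_adherent y A0 e0.
apply: (le_trans (point_set_dist_le x Aa)).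
apply: (le_trans (euclid_dist_triangle y x a)).
by rewrite [e + _]addrC -addrA lerD2l ltW.
Qed.

Definition euclid_bounded A := exists M, forall x, A x -> euclid_norm x <= M.

Let excess A B : R := sup [set point_set_dist a B | a in A].

Lemma point_set_dist_le_excess A B a : euclid_bounded A -> B !=set0 -> A a ->
  point_set_dist a B <= excess A B.
Proof.
move=> [M AM] [b Bb] Aa; apply: ub_le_sup; last by exists a.
exists (M + euclid_norm b) => _ [x Ax <-].
apply: (le_trans (point_set_dist_le x Bb)); rewrite /euclid_dist.
by apply: (le_trans (euclid_normD _ _)); rewrite euclid_normN lerD2r AM.
Qed.

Lemma excess_le A B r : A !=set0 ->
  (forall a, A a -> point_set_dist a B <= r) -> excess A B <= r.
Proof.
move=> [a Aa] h; apply: ge_sup; first by exists (point_set_dist a B), a.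
by move=> _ [x Ax <-]; exact: h.
Qed.

Lemma excess_triangle A B C : euclid_bounded A -> euclid_bounded B ->
  A !=set0 -> B !=set0 -> C !=set0 ->
  excess A C <= excess A B + excess B C.
Proof.
move=> bA bB A0 B0 C0; apply: excess_le => // a Aa.
apply/ler_addgt0Pl => e e0.
have [b Bb h] := point_set_dist_adherent a B0 e0.
apply: (le_trans (point_set_dist_lipschitz a b C0)).
have := point_set_dist_le_excess bB C0 Bb.
have := point_set_dist_le_excess bA B0 Aa.
by move: h; lra.
Qed.

Lemma hausdorff_distC A B : hausdorff_dist A B = hausdorff_dist B A.
Proof. by rewrite /hausdorff_dist maxC. Qed.

Lemma hausdorff_distxx A : A !=set0 -> hausdorff_dist A A = 0.
Proof.
move=> A0; rewrite /hausdorff_dist maxxx.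
have h a : A a -> point_set_dist a A = 0.
  move=> Aa; apply/eqP; rewrite eq_le point_set_dist_ge0// andbT.
  by rewrite -(euclid_distxx a) point_set_dist_le.
rewrite (_ : [set _ | a in A] = [set 0]) ?sup1//.
apply/seteqP; split => [_ [a Aa <-]/=|_ -> /=]; first exact: h.
by have [a Aa] := A0; exists a => //; exact: h.
Qed.

Lemma hausdorff_dist_triangle B A C :
  euclid_bounded A -> euclid_bounded B -> euclid_bounded C ->
  A !=set0 -> B !=set0 -> C !=set0 ->
  hausdorff_dist A C <= hausdorff_dist A B + hausdorff_dist B C.
Proof.
move=> bA bB bC A0 B0 C0; rewrite {1}/hausdorff_dist ge_max; apply/andP; split.
  apply: (le_trans (excess_triangle bA bB A0 B0 C0)).
  by rewrite lerD// le_max lexx.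
apply: (le_trans (excess_triangle bC bB C0 B0 A0)).
by rewrite addrC lerD// le_max lexx orbT.
Qed.

Lemma excess_le0_subset A B : euclid_bounded A -> B !=set0 -> closed B ->
  excess A B <= 0 -> A `<=` B.
Proof.
move=> bA B0 cB h a Aa; apply: cB => U /nbhs_ballP[e /= e0 eU].
have [b Bb ab] := point_set_dist_adherent a B0 e0.
exists b; split => //; apply: eU; rewrite -ball_normE/=.
apply: (le_lt_trans (normr_le_euclid _)); apply: (lt_le_trans ab).
by rewrite gerDr; apply: le_trans h; exact: point_set_dist_le_excess.
Qed.

Lemma hausdorff_dist_eq0 A B : euclid_bounded A -> euclid_bounded B ->
  A !=set0 -> B !=set0 -> closed A -> closed B ->
  hausdorff_dist A B = 0 -> A = B.
Proof.
move=> bA bB A0 B0 cA cB h.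
have /andP[hA hB] : (excess A B <= 0) && (excess B A <= 0).
  by rewrite -ge_max -h lexx.
by apply/seteqP; split; apply: excess_le0_subset.
Qed.

Lemma compact_euclid_bounded A : compact A -> euclid_bounded A.
Proof.
move=> /compact_bounded [M [_ /(_ (M + 1))]]; rewrite ltrDl ltr01 => /(_ isT) AM.
exists (Num.sqrt (\sum_(i < n) (M + 1) ^+ 2)) => x /AM /= xM.
apply: ler_wsqrtr; apply: ler_sum => i _.
rewrite -real_normK ?num_real//; apply: lerXn2r; rewrite ?nnegrE//.
  exact: le_trans xM.
apply: le_trans xM; rewrite [leRHS]/Num.norm/= mx_normrE; apply/bigmax_geP; right => /=.
  by exists (0, i).
Qed.

End EuclideanHausdorff.

Section ConvexHull.
Context {R : realType} {n : nat}.
Implicit Types (x y : 'rV[R]_n) (A : set 'rV[R]_n).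

Definition convex_hull A : set 'rV[R]_n := smallest (@convex_set R 'rV[R]_n) A.

Definition polytope A := exists2 V, finite_set V & A = convex_hull V.

Lemma convex_setP A : convex_set (A : set (convex_lmodType 'rV[R]_n)) <->
  forall x y (t : R), 0 <= t <= 1 -> A x -> A y -> A (t *: x + (1 - t) *: y).
Proof.
split => [cA x y t t01 Ax Ay|cA x y t /set_mem Ax /set_mem Ay].
  have /andP[t0 t1] := t01.
  have := cA x y (Itv01 t0 t1).
  by rewrite !inE => /(_ Ax Ay).
apply/mem_set; apply: (cA x y t%:num) => //.
by apply/andP; split.
Qed.

Definition segment_map (x : 'rV[R]_n) (p : R * 'rV[R]_n) := p.1 *: x + (1 - p.1) *: p.2.

Fixpoint hull_seq (s : seq 'rV[R]_n) : set 'rV[R]_n :=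
  if s is x :: s' then [set x] `|` (segment_map x @` (`[0, 1] `*` hull_seq s'))
  else set0.

Lemma convex_hull_seq s : convex_set (hull_seq s : set (convex_lmodType 'rV[R]_n)).
Proof.
elim: s => [|x s /convex_setP IH]; apply/convex_setP => //= u v t t01.
have onex w a : 0 <= a <= 1 -> hull_seq s w ->
    ([set x] `|` (segment_map x @` (`[0, 1] `*` hull_seq s))) (segment_map x (a, w)).
  by move=> a01 hw; right; exists (a, w).
have /andP[t0 t1] := t01.
move=> [->|[[a y] [/=]]]; last rewrite ?in_itv/= => /andP[a0 a1] hy <-.
  move=> [->|[[b z] [/=]]]; first by left; rewrite -scalerDl addrCA subrr addr0 scale1r.
  rewrite ?in_itv/= => /andP[b0 b1] hz <-.
  rewrite (_ : _ + _ = segment_map x (t + (1 - t) * b, z)); first by apply: onex => //; nra.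
  by apply/rowP => i; rewrite /segment_map !mxE/=; ring.
move=> [->|[[b z] [/=]]].
  rewrite (_ : _ + _ = segment_map x (t * a + (1 - t), y)); first by apply: onex => //; nra.
  by apply/rowP => i; rewrite /segment_map !mxE/=; ring.
rewrite ?in_itv/= => /andP[b0 b1] hz <-.
pose c := t * a + (1 - t) * b.
have c01 : 0 <= c <= 1 by rewrite /c; nra.
have [c1|cN1] := eqVneq c 1.
  have ta : t * (1 - a) = 0 by apply/eqP; rewrite eq_le; move: c1; rewrite /c; nra.
  have tb : (1 - t) * (1 - b) = 0 by apply/eqP; rewrite eq_le; move: c1; rewrite /c; nra.
  left; apply/rowP => i; rewrite /segment_map !mxE/=.
  transitivity (c * x 0 i + t * (1 - a) * y 0 i + (1 - t) * (1 - b) * z 0 i).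
    by rewrite /c; ring.
  by rewrite c1 ta tb !mul0r !addr0 mul1r.
have c1 : 0 < 1 - c by rewrite subr_gt0 lt_neqAle cN1; case/andP: c01.
pose r := t * (1 - a) / (1 - c).
have rE : 1 - r = (1 - t) * (1 - b) / (1 - c).
  by rewrite /r; move: c1 => /lt0r_neq0; rewrite /c => c1; field.
rewrite (_ : _ + _ = segment_map x (c, r *: y + (1 - r) *: z)).
  apply: onex => //; apply: IH => //; apply/andP; split.
    by rewrite /r divr_ge0 ?(ltW c1)// mulr_ge0// subr_ge0.
  by rewrite -subr_ge0 rE divr_ge0 ?(ltW c1)// mulr_ge0// subr_ge0.
apply/rowP => i; rewrite rE /segment_map !mxE/= /r; move: c1 => /lt0r_neq0.
by rewrite /c => c1; field.
Qed.

Lemma convex_hull_seqE s : convex_hull [set` s] = hull_seq s.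
Proof.
apply/seteqP; split.
  apply: smallest_sub; first exact: convex_hull_seq.
  elim: s => [//|x s IH] y /=; rewrite in_cons => /predU1P[->|ys]; first by left.
  right; exists (0, y) => /=; first by split => //=; [rewrite ?in_itv/= lexx ler01|exact: IH].
  by rewrite /segment_map/= scale0r add0r subr0 scale1r.
move=> y hy B [cB sB]; elim: s y sB hy => [//|x s IH] y sB /= [->|].
  by apply: sB; rewrite /= mem_head.
move=> [[a z] [/=]]; rewrite ?in_itv/= => a01 hz <-.
move/convex_setP : (cB); apply => //; first by apply: sB; rewrite /= mem_head.
by apply: IH => // w ws; apply: sB; rewrite /= in_cons ws orbT.
Qed.

Lemma polytope_compact A : polytope A -> compact A.
Proof.
move=> [_ /finite_seqP[s ->] ->]; rewrite convex_hull_seqE.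
elim: s => [|x s IH] /=; first exact: compact0.
apply: compactU; first exact: compact_set1.
apply: continuous_compact.
  apply: continuous_subspaceT => -[a y] /=; rewrite /segment_map/=.
  apply: cvgD; first by apply: cvgZl; exact: cvg_fst.
  by apply: cvgZ; [apply: cvgB; [exact: cvg_cst|exact: cvg_fst]|exact: cvg_snd].
by apply: compact_setX => //; exact: segment_compact.
Qed.

End ConvexHull.

Section DelzantPolytopes.
Context {R : realType} {n : nat}.
Implicit Types (x y v : 'rV[R]_n) (alpha : 'cV[R]_n) (A F E P : set 'rV[R]_n).

(* Points are row vectors, linear forms on R^n are column vectors. *)
Definition pairing alpha x : R := (x *m alpha) 0 0.

Definition face P F := exists alpha c,
  P `<=` [set x | pairing alpha x <= c] /\
  F = P `&` [set x | pairing alpha x = c].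

(* U is the linear subspace parallel to the affine hull of A. *)
Definition is_direction_space A (U : {vspace 'rV[R]_n}) :=
  let contains_differences (W : {vspace 'rV[R]_n}) :=
    forall x y, A x -> A y -> x - y \in W in
  contains_differences U /\
  forall W, contains_differences W -> (U <= W)%VS.

Definition has_dimension A (d : nat) :=
  A !=set0 /\ exists2 U, is_direction_space A U & \dim U = d.

Definition vertex P v := face P [set v].

Definition edge P E := face P E /\ has_dimension E 1.

Definition primitive (u : 'rV[int]_n) : Prop := \big[gcdz/0]_i u 0 i = 1.

Definition edge_vectors P v : set 'rV[int]_n := [set u | primitive u /\
  exists E, [/\ edge P E, E v &
    exists2 t : R, 0 < t & E (v + t *: map_mx intr u)]].

(* The rows of B form a basis of the lattice Z^n. *)
Definition lattice_basis (B : 'M[int]_n) :=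
  forall z : 'rV[int]_n, exists! c : 'rV[int]_n, z = c *m B.

Record delzant_polytope P : Prop := DelzantPolytope {
  delzant_is_polytope : polytope P;
  delzant_full_dimensional : has_dimension P n;
  delzant_simple : forall v, vertex P v ->
    ([set E | edge P E /\ E v] #= `I_n)%card;
  delzant_rational : forall E, edge P E ->
    exists u : 'rV[rat]_n, is_direction_space E <[map_mx ratr u]>;
  delzant_smooth : forall v, vertex P v ->
    exists2 B : 'M[int]_n, lattice_basis B &
      range (fun i => row i B) = edge_vectors P v
}.

Definition normal_cone P F : set 'cV[R]_n :=
  [set alpha | forall p q, F p -> P q -> 0 <= pairing alpha (p - q)].

Definition normal_fan P : set (set 'cV[R]_n) :=
  [set normal_cone P F | F in [set F | face P F /\ F !=set0]].

End DelzantPolytopes.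

Record delzant (R : realType) (n : nat) := Delzant {
  delzant_set :> set 'rV[R]_n;
  delzant_setP : delzant_polytope delzant_set
}.

Section DelzantMetric.
Context {R : realType} {n : nat}.
Implicit Types P Q : delzant R n.

HB.instance Definition _ := gen_eqMixin (delzant R n).
HB.instance Definition _ := gen_choiceMixin (delzant R n).

Lemma delzant_inj P Q : P = Q :> set _ -> P = Q.
Proof.
case: P Q => [P hP] [Q hQ] /= PQ; case: _ / PQ in hQ *.
by congr Delzant; exact: Prop_irrelevance.
Qed.

Lemma delzant_compact P : compact P.
Proof. exact/polytope_compact/delzant_is_polytope/delzant_setP. Qed.

Lemma delzant_nonempty P : delzant_set P !=set0.
Proof. by have [] := delzant_full_dimensional (delzant_setP P). Qed.

Lemma delzant_closed P : closed P.
Proof. by apply: compact_closed; [exact: norm_hausdorff|exact: delzant_compact]. Qed.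

Lemma delzant_bounded P : euclid_bounded P.
Proof. exact/compact_euclid_bounded/delzant_compact. Qed.

Definition delzant_dist P Q : R := hausdorff_dist P Q.

Lemma delzant_distxx P : delzant_dist P P = 0.
Proof. exact/hausdorff_distxx/delzant_nonempty. Qed.

Lemma delzant_dist_eq0 P Q : delzant_dist P Q = 0 -> P = Q.
Proof.
move=> h; apply/delzant_inj/hausdorff_dist_eq0 => //;
  by [exact: delzant_bounded|exact: delzant_nonempty|exact: delzant_closed].
Qed.

Lemma delzant_distC P Q : delzant_dist P Q = delzant_dist Q P.
Proof. exact: hausdorff_distC. Qed.

Lemma delzant_dist_triangle Q P S :
  delzant_dist P S <= delzant_dist P Q + delzant_dist Q S.
Proof.
by apply: hausdorff_dist_triangle;
  [exact: delzant_bounded..|exact: delzant_nonempty|exact: delzant_nonempty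
  |exact: delzant_nonempty].
Qed.

HB.instance Definition _ := isMetric.Build R (delzant R n)
  delzant_distxx delzant_dist_eq0 delzant_distC delzant_dist_triangle.

End DelzantMetric.

Section UnitInterval.
Context {R : realType}.

Definition unit_interval : Type := set_type (`[0, 1] : set R).

HB.instance Definition _ :=
  Topological.copy unit_interval (set_type (`[0, 1] : set R)).

Let zero_in : (0 : R) \in `[0, 1]%classic.
Proof. by rewrite inE/= in_itv/= lexx ler01. Qed.

Let one_in : (1 : R) \in `[0, 1]%classic.
Proof. by rewrite inE/= in_itv/= lexx ler01. Qed.

Let zero_neq_one : exist _ 0 zero_in != exist _ 1 one_in :> unit_interval.
Proof. by rewrite -val_eqE/= eq_sym oner_eq0. Qed.

HB.instance Definition _ := isBiPointed.Build unit_interval zero_neq_one.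

End UnitInterval.
Arguments unit_interval R : clear implicits.

Section Homotopy.
Context {R : realType} {T : topologicalType}.
Local Notation I := (unit_interval R).

(* Homotopy relative to the endpoints. *)
Definition path_homotopic {x y : T} (f g : {path I from x to y in T}) :=
  exists2 H : I * I -> T, continuous H &
    [/\ forall t, H (zero, t) = f t, forall t, H (one, t) = g t,
        forall s, H (s, zero) = x & forall s, H (s, one) = y].

Definition null_homotopic {x : T} (f : {path I from x to x in T}) :=
  path_homotopic f (cst x).

End Homotopy.

Definition finite_complexity {R : realType} {n : nat} {P Q : delzant R n}
    (gamma : {path unit_interval R from P to Q}) :=
  finite_set (range (fun t => normal_fan (gamma t))).

(* Main.v *)
Require Import Defs.
From mathcomp Require Import all_boot all_order all_algebra.
From mathcomp Require Import all_classical all_reals all_analysis.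
From mathcomp Require Import homotopy.
From mathcomp Require Import ring lra zify.

(** The loop is contracted by weighted Minkowski sums. Let [Q] be a smooth
    polytope whose normal fan refines the normal fans of all the [gamma t]. The
    homotopy is
      [H (s, t) = (1 - s) gamma(t) + s P + s (1 - s) t (1 - t) Q].
    It starts at [gamma]; for [s = 1], and for [t = 0] or [t = 1], the last
    coefficient vanishes and the convexity of [P] makes the sum equal to [P].
    All values are Delzant: where the coefficient of [Q] is positive, the normal
    fan of the sum is that of [Q], because the fans of the two other summands are
    coarser, and being Delzant depends on the normal fan only ([blend_delzant],
    which rests on the criterion [delzant_criterion]).
    Continuity is an estimate of Hausdorff distances ([blend_hausdorff]).

    The existence of [Q] is a projective resolution of singularities for a fan
    that refines finitely many given ones ([common_refinement]). It splits into
    two steps.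

    First, let [X] be a polytope with rational edges. If the hyperplanes
    orthogonal to its edges do not cut a unimodular cone, then some point of [X]
    minimises all the forms of that cone at once ([edge_directions]). The reason
    is that [X] lies, at a vertex, in the cone spanned by the edges there; the
    edges are obtained as the exposed rays of the cone spanned by [X], by
    separating points from convex hulls. The conclusion is a property of the
    normal fan alone, so a finite list of integral hyperplanes serves for all the
    polytopes of a path of finite complexity.

    Secondly, the fan of a cube is refined until none of these hyperplanes cuts a
    cone ([resolution]). Following De Concini and Procesi, one repeatedly takes
    two rays [u] and [v] of a common cone that lie strictly on either side of the
    hyperplane, with the largest difference of slopes, and performs the star
    subdivision at [u + v]. The slope of [u + v] lies strictly between those of
    [u] and [v], so this removes a pair of largest difference and creates none;
    and the cones that a hyperplane does not cut are only subdivided, so the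
    hyperplanes treated before are respected. A star subdivision along a
    two-dimensional cone of a unimodular fan is again unimodular, and on the
    polytope it cuts off a face of codimension two, so the fan stays the normal
    fan of a polytope ([star_smooth_fan]). *)

Set Implicit Arguments.
Unset Strict Implicit.
Unset Printing Implicit Defensive.

Import Order.TTheory GRing.Theory Num.Theory.
Import numFieldNormedType.Exports.

Local Open Scope classical_set_scope.
Local Open Scope ring_scope.

(** * Linear forms, separation and cones *)

Section Pairing.
Context {R : realType} {n : nat}.
Implicit Types (x y : 'rV[R]_n) (alpha beta : 'cV[R]_n) (c : R).

Lemma pairingE alpha x : pairing alpha x = \sum_i x 0 i * alpha i 0.
Proof. by rewrite /pairing mxE. Qed.

Lemma pairing0r alpha : pairing alpha 0 = 0.
Proof. by rewrite /pairing mul0mx mxE. Qed.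

Lemma pairingDr alpha x y : pairing alpha (x + y) = pairing alpha x + pairing alpha y.
Proof. by rewrite /pairing mulmxDl mxE. Qed.

Lemma pairingNr alpha x : pairing alpha (- x) = - pairing alpha x.
Proof. by rewrite /pairing mulNmx mxE. Qed.

Lemma pairingBr alpha x y : pairing alpha (x - y) = pairing alpha x - pairing alpha y.
Proof. by rewrite pairingDr pairingNr. Qed.

Lemma pairingZr alpha c x : pairing alpha (c *: x) = c * pairing alpha x.
Proof. by rewrite /pairing -scalemxAl mxE. Qed.

Lemma pairingDl alpha beta x : pairing (alpha + beta) x = pairing alpha x + pairing beta x.
Proof. by rewrite /pairing mulmxDr mxE. Qed.

Lemma pairingNl alpha x : pairing (- alpha) x = - pairing alpha x.
Proof. by rewrite /pairing mulmxN mxE. Qed.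

Lemma pairingZl alpha c x : pairing (c *: alpha) x = c * pairing alpha x.
Proof. by rewrite /pairing -scalemxAr mxE. Qed.

Lemma pairing_suml (I : finType) (alpha : I -> 'cV[R]_n) x :
  pairing (\sum_i alpha i) x = \sum_i pairing (alpha i) x.
Proof. by rewrite /pairing mulmx_sumr summxE. Qed.

Definition pairing_simp :=
  (pairing0r, pairingDr, pairingNr, pairingZr, pairingDl, pairingNl, pairingZl).

End Pairing.

Section Convexity.
Context {R : realType} {n : nat}.
Implicit Types (x y : 'rV[R]_n) (alpha : 'cV[R]_n) (s : seq 'rV[R]_n) (A : set 'rV[R]_n).

Local Notation is_convex A := (convex_set (A : set (convex_lmodType 'rV[R]_n))).

Lemma hull_sub_convex s A : is_convex A -> (forall x, x \in s -> A x) ->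
  hull_seq s `<=` A.
Proof. by move=> cA sA; rewrite -convex_hull_seqE; apply: smallest_sub. Qed.

Lemma mem_hull_seq s x : x \in s -> hull_seq s x.
Proof. by rewrite -convex_hull_seqE => xs B [_]; apply. Qed.

Lemma convex_halfspace alpha c : is_convex [set x | c <= pairing alpha x].
Proof.
apply/convex_setP => x y t /andP[t0 t1] /= hx hy; rewrite !pairing_simp.
nra.
Qed.

Lemma continuous_sqdist y :
  continuous (fun x => \sum_i (x 0 i - y 0 i) ^+ 2 : R).
Proof.
move=> x; have FF : Filter (nbhs x) := nbhs_filter x.
rewrite /continuous_at; elim: (index_enum _) => [|i r IH].
  rewrite big_nil (_ : (fun _ => _) = cst 0).
  exact: cvg_cst.
  by apply/funext => z; rewrite big_nil.
rewrite big_cons (_ : (fun _ => _) = fun z : 'rV[R]_n => (z 0 i - y 0 i) ^+ 2 +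
    \sum_(j <- r) (z 0 j - y 0 j) ^+ 2); last first.
  by apply/funext => z; rewrite big_cons.
have h : (fun z : 'rV[R]_n => z 0 i - y 0 i) @ x --> x 0 i - y 0 i.
  by apply: cvgB; [exact: coord_continuous|exact: cvg_cst].
by apply: cvgD IH; exact: cvgM.
Qed.

(** The point of the hull nearest to [y] provides the separating form: moving
    from it towards a generator cannot decrease the distance to [y]. *)
Lemma hull_separation s y : ~ hull_seq s y ->
  exists beta, forall x, x \in s -> 0 < pairing beta (x - y).
Proof.
move=> yNs; have [s0|s0] := eqVneq s [::].
  by exists 0 => x; rewrite s0.
have hull0 : hull_seq s !=set0.
  by case: s s0 {yNs} => // x s _; exists x; exact: mem_hull_seq (mem_head _ _).
have hull_compact : compact (hull_seq s).
  by apply: polytope_compact; exists [set` s]; rewrite ?convex_hull_seqE.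
have [z zs zmin] := EVT_min_rV hull0 hull_compact
  (continuous_subspaceT (@continuous_sqdist y)).
rewrite inE in zs.
exists (z - y)^T => x xs.
have norm_gt0 : 0 < \sum_i (z 0 i - y 0 i) ^+ 2.
  rewrite lt_neqAle sumr_ge0 ?andbT; last by move=> i _; rewrite sqr_ge0.
  rewrite eq_sym psumr_eq0; last by move=> i _; rewrite sqr_ge0.
  apply/negP => /allP h; apply: yNs; rewrite (_ : y = z)//.
  apply/rowP => i; have := h i; rewrite mem_index_enum sqrf_eq0 subr_eq0.
  by move=> /(_ isT)/eqP.
apply: (lt_le_trans norm_gt0); rewrite pairingE.
under [leRHS]eq_bigr do rewrite !mxE.
(* first-order condition at [z] along the segment from [z] to [x] *)
set p := \sum_i (x 0 i - z 0 i) * (z 0 i - y 0 i).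
suff p0 : 0 <= p.
  rewrite -subr_ge0 -sumrB; apply: (le_trans p0).
  by apply: ler_sum => i _; rewrite le_eqVlt; apply/orP; left; apply/eqP; ring.
pose q := \sum_i (x 0 i - z 0 i) ^+ 2.
have q0 : 0 <= q by apply: sumr_ge0 => i _; rewrite sqr_ge0.
have move_ge t : 0 <= t <= 1 -> 0 <= t * (2 * p + t * q).
  move=> t01; have /convex_setP hull_convex := @convex_hull_seq R n s.
  have h := hull_convex x z t t01.
  have /mem_set/zmin := h (mem_hull_seq xs) zs.
  rewrite -subr_ge0 -sumrB => /le_trans; apply.
  rewrite /p /q mulrDr !mulr_sumr -big_split/=; apply: ler_sum => i _.
  by rewrite !mxE le_eqVlt; apply/orP; left; apply/eqP; ring.
rewrite leNgt; apply/negP => pN.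
pose t := - p / (q - p).
have qp : 0 < q - p by lra.
have t0 : 0 < t by rewrite /t divr_gt0// oppr_gt0.
have t1 : t <= 1 by rewrite /t ler_pdivrMr//; lra.
have tq : t * (q - p) = - p by rewrite /t divfK// gt_eqF.
have := move_ge t; rewrite (ltW t0) t1 => /(_ isT).
rewrite pmulr_rge0//.
have : t * q <= - p by rewrite -tq; nra.
lra.
Qed.

End Convexity.

Section Cones.
Context {R : realType} {n : nat}.
Implicit Types (x y d : 'rV[R]_n) (beta phi : 'cV[R]_n) (D E : seq 'rV[R]_n).

Inductive cone D : 'rV[R]_n -> Prop :=
| Cone0 : cone D 0
| ConeD d c x : d \in D -> 0 <= c -> cone D x -> cone D (c *: d + x).

Lemma cone_gen D d c : d \in D -> 0 <= c -> cone D (c *: d).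
Proof. by move=> dD c0; rewrite -[_ *: _]addr0; apply: ConeD => //; exact: Cone0. Qed.

Lemma cone_add D x y : cone D x -> cone D y -> cone D (x + y).
Proof.
move=> hx hy; elim: hx => [|d c z dD c0 _ IH]; first by rewrite add0r.
by rewrite -addrA; apply: ConeD.
Qed.

Lemma cone_scale D x c : 0 <= c -> cone D x -> cone D (c *: x).
Proof.
move=> c0; elim=> [|d b z dD b0 _ IH]; first by rewrite scaler0; exact: Cone0.
by rewrite scalerDr scalerA; apply: ConeD => //; rewrite mulr_ge0.
Qed.

Lemma cone_trans D E x : (forall d, d \in D -> cone E d) -> cone D x -> cone E x.
Proof.
move=> DE; elim=> [|d c z dD c0 _ IH]; first exact: Cone0.
by apply: cone_add => //; apply: cone_scale => //; exact: DE.
Qed.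

Lemma pairing_cone_ge0 D beta x : (forall d, d \in D -> 0 <= pairing beta d) ->
  cone D x -> 0 <= pairing beta x.
Proof.
move=> D0; elim=> [|d c z dD c0 _ IH]; rewrite !pairing_simp//.
by rewrite addr_ge0// mulr_ge0// D0.
Qed.

(** The reason why an exposed ray of the cone at a vertex is an edge, and not a
    face of higher dimension. *)
Lemma cone_ray D beta d x :
  pairing beta d = 0 ->
  (forall e, e \in D -> e != d -> 0 < pairing beta e) ->
  cone D x -> pairing beta x = 0 -> exists c, x = c *: d.
Proof.
move=> bd be; have D0 e : e \in D -> 0 <= pairing beta e.
  by have [->|ed] := eqVneq e d; [rewrite bd|move=> /be/(_ ed)/ltW].
elim=> [_|e c z eD c0 hz IH]; first by exists 0; rewrite scale0r.
rewrite !pairing_simp => h.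
have z0 := pairing_cone_ge0 D0 hz; have e0 := mulr_ge0 c0 (D0 _ eD).
have [|b zE] := IH; first by lra.
have [ed|/(be _ eD) e_gt0] := eqVneq e d.
  by exists (c + b); rewrite ed zE scalerDl.
have /eqP : c * pairing beta e = 0 by lra.
rewrite mulf_eq0 (gt_eqF e_gt0) orbF => /eqP ->.
by exists b; rewrite scale0r add0r.
Qed.

Definition exposed D d := exists2 beta : 'cV[R]_n, pairing beta d = 0 &
  forall e, e \in D -> e != d -> 0 < pairing beta e.

(** If a generator [d] of a pointed cone is not exposed, then along the
    projection that kills [d] the other generators have 0 in their convex
    hull, which expresses [d] through them. *)
Lemma nonexposed_redundant D d phi :
  (forall e, e \in D -> 0 < pairing phi e) -> d \in D -> ~ exposed D d ->
  cone [seq e <- D | e != d] d.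
Proof.
move=> phi0 dD dNe; set D1 := [seq e <- D | e != d].
have d0 := phi0 _ dD.
pose pr x := x - (pairing phi x / pairing phi d) *: d.
have hull0 : hull_seq (map pr D1) 0.
  apply: contrapT => /hull_separation[beta hbeta]; apply: dNe.
  exists (beta - (pairing beta d / pairing phi d) *: phi).
    by rewrite !pairing_simp divfK ?subrr// gt_eqF.
  move=> e eD ed.
  have := hbeta (pr e); rewrite map_f ?mem_filter ?ed// subr0 => /(_ isT).
  by rewrite /pr !pairing_simp mulrAC [_ / _ * _]mulrAC (mulrC (pairing phi e)).
have hull_cone : forall y, hull_seq (map pr D1) y ->
    exists x, [/\ cone D1 x, 0 < pairing phi x & y = pr x].
  apply: hull_sub_convex; last first.
    move=> _ /mapP[e eD ->]; exists e; split => //.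
      by rewrite -[e]scale1r; apply: cone_gen.
    by apply: phi0; move: eD; rewrite mem_filter => /andP[].
  apply/convex_setP => _ _ t t01 [x1 [h1 p1 ->]] [x2 [h2 p2 ->]].
  have /andP[t0 t1] := t01.
  exists (t *: x1 + (1 - t) *: x2); split.
  - by apply: cone_add; apply: cone_scale => //; rewrite subr_ge0.
  - by rewrite !pairing_simp; nra.
  - by apply/rowP => i; rewrite /pr !pairing_simp !mxE; field; rewrite gt_eqF.
have [x [hx x0 /eqP]] := hull_cone _ hull0.
rewrite eq_sym subr_eq0 => /eqP xE.
have -> : d = (pairing phi d / pairing phi x) *: x.
  rewrite [X in _ *: X]xE scalerA (_ : _ * _ = 1) ?scale1r//.
  by field; rewrite !gt_eqF.
by apply: cone_scale => //; rewrite divr_ge0// ltW.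
Qed.

(** Redundant generators are discarded one at a time; the form [phi], which makes
    the cone pointed, ensures that a generator is redundant or exposed. *)
Lemma cone_exposed D phi : (forall e, e \in D -> 0 < pairing phi e) ->
  exists D', [/\ {subset D' <= D}, forall d, d \in D -> cone D' d &
    forall d, d \in D' -> exposed D' d].
Proof.
have [m] := ubnP (size D); elim: m D => // m IH D; rewrite ltnS => sD phi0.
have [all_exp|] := pselect (forall d, d \in D -> exposed D d).
  by exists D; split=> // d dD; rewrite -[d]scale1r; apply: cone_gen.
move=> /existsNP[d /not_implyP[dD dNe]].
have dcone := nonexposed_redundant phi0 dD dNe.
set D1 := [seq e <- D | e != d] in dcone.
have D1D : {subset D1 <= D} by move=> e; rewrite mem_filter => /andP[].
have [||D' [D'D1 D1cone D'exp]] := IH D1.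
- apply: leq_trans sD; rewrite size_filter -[X in (_ < X)%N](count_predC (fun e => e != d)).
  rewrite -[X in (X < _)%N]addn0 ltn_add2l -has_count.
  by apply/hasP; exists d => //=; rewrite eqxx.
- by move=> e /D1D/phi0.
exists D'; split => // [e /D'D1/D1D//|e eD].
have [->|ed] := eqVneq e d; first exact: cone_trans dcone.
by apply: D1cone; rewrite mem_filter ed.
Qed.

End Cones.

(** * Edges of a rational polytope and the cones they do not cut *)

Section EdgeDirections.
Context {R : realType} {n : nat}.
Implicit Types (x g d : 'rV[R]_n) (phi : 'cV[R]_n) (X F E : set 'rV[R]_n).
Implicit Types (D V : seq 'rV[R]_n) (A : 'M[int]_n) (e : 'rV[int]_n).

Local Notation real_mx := (map_mx (intr : int -> R)).

Lemma is_direction_line E d : d != 0 ->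
  (exists x y, [/\ E x, E y & y = x + d]) ->
  (forall x y, E x -> E y -> exists c, x - y = c *: d) ->
  is_direction_space E <[d]>.
Proof.
move=> d0 [x [y [Ex Ey yE]]] Eline; split.
  by move=> u v Eu Ev; apply/vlineP; exact: Eline.
by move=> W /(_ y x Ey Ex); rewrite yE addrAC subrr add0r -memvE.
Qed.

Lemma edge_of_line X E d : face X E -> d != 0 ->
  (exists x y, [/\ E x, E y & y = x + d]) ->
  (forall x y, E x -> E y -> exists c, x - y = c *: d) -> edge X E.
Proof.
move=> fE d0 hd hE; split=> //; split; first by have [x [? []]] := hd; exists x.
by exists <[d]>%VS; [exact: is_direction_line|rewrite dim_vline d0].
Qed.

Lemma exposed_edge X D g d : X g -> X (g + d) -> d != 0 ->
  (forall x, X x -> cone D (x - g)) -> d \in D -> exposed D d ->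
  exists E, [/\ edge X E, E g & E (g + d)].
Proof.
move=> Xg Xgd d0 XD dD [beta bd be].
pose E := X `&` [set x | pairing (- beta) x = pairing (- beta) g].
have D0 d' : d' \in D -> 0 <= pairing beta d'.
  by have [->|dd] := eqVneq d' d; [rewrite bd|move=> /be/(_ dd)/ltW].
have Eg : E g by [].
have Egd : E (g + d) by split => //=; rewrite !pairing_simp bd oppr0 addr0.
exists E; split => //; apply: (@edge_of_line _ _ d) => //.
- exists (- beta), (pairing (- beta) g); split => // x Xx /=.
  have := pairing_cone_ge0 D0 (XD _ Xx).
  by rewrite !pairing_simp lerNl opprK subr_ge0.
- by exists g, (g + d).
have line x : E x -> exists c, x - g = c *: d.
  move=> [Xx /= xg]; apply: (cone_ray bd be (XD _ Xx)).
  by move: xg; rewrite !pairing_simp => /oppr_inj->; rewrite subrr.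
move=> x y /line[a xa] /line[b yb]; exists (a - b).
by rewrite scalerBl -xa -yb opprB addrA subrK.
Qed.

(** The vectors from [g] to the other generators of the polytope span a pointed
    cone, and its exposed rays are edges of the polytope. *)
Lemma polytope_sub_edge_cone V g phi : g \in V ->
  (forall v, v \in V -> v != g -> 0 < pairing phi (v - g)) ->
  exists D, [/\ forall d, d \in D -> 0 < pairing phi d,
    forall d, d \in D -> exists2 v, v \in V & d = v - g,
    forall d, d \in D ->
      exists E, [/\ edge (hull_seq V) E, E g & E (g + d)] &
    forall x, hull_seq V x -> cone D (x - g)].
Proof.
move=> gV phi0; set D0 := [seq v - g | v <- V & v != g].
have D0pos d : d \in D0 -> 0 < pairing phi d.
  by move=> /mapP[v]; rewrite mem_filter => /andP[vg vV] ->; exact: phi0.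
have [D [DD0 D0cone Dexp]] := cone_exposed D0pos.
have VD x : hull_seq V x -> cone D (x - g).
  move: x; apply: hull_sub_convex => [|x xV].
    apply/convex_setP => x y t /andP[t0 t1] hx hy.
    have -> : t *: x + (1 - t) *: y - g = t *: (x - g) + (1 - t) *: (y - g).
      by apply/rowP => i; rewrite !mxE; ring.
    by apply: cone_add; apply: cone_scale => //; rewrite subr_ge0.
  have [->|xg] := eqVneq x g; first by rewrite subrr; exact: Cone0.
  by apply: D0cone; apply/mapP; exists x => //; rewrite mem_filter xg.
exists D; split => // [d /DD0/D0pos//|d /DD0/mapP[v]|d dD].
  by rewrite mem_filter => /andP[_ vV] ->; exists v.
apply: (@exposed_edge _ D) => //; first exact: mem_hull_seq.
- have /mapP[v] := DD0 _ dD; rewrite mem_filter => /andP[_ vV] ->.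
  by rewrite addrC subrK; exact: mem_hull_seq.
- by apply/eqP => d0; have := D0pos _ (DD0 _ dD); rewrite d0 pairing0r ltxx.
- exact: Dexp.
Qed.

Lemma rational_direction (u : 'rV[rat]_n) :
  exists e (c : R), map_mx ratr u = c *: real_mx e.
Proof.
pose den := \prod_i denq (u 0 i).
exists (\row_i (numq (u 0 i) * \prod_(j | j != i) denq (u 0 j))), (den%:~R)^-1.
apply/rowP => i; rewrite !mxE /den (bigD1 i)//= /ratr.
rewrite !intrM.
have h : (\prod_(j | j != i) denq (u 0 j))%:~R != 0 :> R.
  by rewrite intr_eq0; apply/prodf_neq0 => j _; rewrite denq_neq0.
by field; rewrite h intr_eq0 denq_neq0.
Qed.

Lemma positive_nonroot (p : {poly R}) : p != 0 -> exists2 eps, 0 < eps & p.[eps] != 0.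
Proof.
move=> p0; apply: contrapT => h.
pose s := [seq k.+1%:R | k <- iota 0 (size p)] : seq R.
have : (size s < size p)%N.
  apply: max_poly_roots => //.
    apply/allP => _ /mapP[k _ ->]; apply: contrapT => /negP hk.
    by apply: h; exists k.+1%:R; rewrite ?ltr0Sn.
  rewrite map_inj_uniq ?iota_uniq// => i j /eqP.
  by rewrite eqr_nat eqSS => /eqP.
by rewrite size_map size_iota ltnn.
Qed.

Lemma unit_real_mxK A : A \in unitmx -> real_mx A *m real_mx (invmx A) = 1%:M.
Proof. by move=> uA; rewrite -map_mxM mulmxV// map_mx1. Qed.

Lemma unit_real_mxVK A : A \in unitmx -> real_mx (invmx A) *m real_mx A = 1%:M.
Proof. by move=> uA; rewrite -map_mxM mulVmx// map_mx1. Qed.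

Lemma pairing_col (B : 'M[R]_n) x j : pairing (col j B) x = (x *m B) 0 j.
Proof. by rewrite /pairing colE mulmxA -colE mxE. Qed.

(** The weights are powers of a number that is not a root of any of the
    polynomials which the pairs of points give rise to. *)
Lemma generic_interior_form V A : A \in unitmx ->
  exists2 w : 'I_n -> R, forall j, 0 < w j &
  forall v v', v \in V -> v' \in V ->
    \sum_j w j * pairing (col j (real_mx A)) (v - v') = 0 -> v = v'.
Proof.
move=> uA.
pose p (vv : 'rV[R]_n * 'rV[R]_n) : {poly R} :=
  \poly_(j < n) (if insub j is Some k then
    pairing (col k (real_mx A)) (vv.1 - vv.2) else 0).
pose q := \prod_(vv <- [seq (v, v') | v <- V, v' <- V] | p vv != 0) p vv.
have [eps eps0 qeps] : exists2 eps, 0 < eps & q.[eps] != 0.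
  by apply: positive_nonroot; rewrite prodf_seq_neq0; apply/allP => vv _; apply/implyP.
exists (fun j : 'I_n => eps ^+ j) => [j|v v' vV v'V].
  exact: exprn_gt0.
have -> : \sum_(j < n) eps ^+ j * pairing (col j (real_mx A)) (v - v') =
    (p (v, v')).[eps].
  by rewrite horner_poly; apply: eq_bigr => j _; rewrite valK mulrC.
move=> h; have [p0|pN0] := eqVneq (p (v, v')) 0; last first.
  move/negP: qeps; case; rewrite /q horner_prod.
  rewrite (big_rem (v, v')) /=; last by apply/allpairsP; exists (v, v').
  by rewrite pN0 h mul0r.
apply/eqP; rewrite -subr_eq0; apply/eqP.
rewrite -[LHS]mulmx1 -(unit_real_mxK uA) mulmxA.
rewrite (_ : (v - v') *m real_mx A = 0) ?mul0mx//.
apply/rowP => j; rewrite -pairing_col mxE.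
have := congr1 (fun r : {poly R} => r`_j) p0.
by rewrite /p coef_poly ltn_ord valK coef0.
Qed.

Definition uncut e A := forall i j, 0 < (e *m A) 0 i -> 0 <= (e *m A) 0 j.

(** The columns of [A] stand for inward normals, whereas normal fans consist of
    outward ones: hence the sign. *)
Definition subordinate (fan : set (set 'cV[R]_n)) A :=
  exists2 N, fan N & forall j, N (- col j (real_mx A)).

(** Take the vertex [g] that minimises a generic positive combination of the
    columns of [A]. This combination is positive on each edge direction at [g],
    and no column disagrees in sign with another one there, so that all columns
    are nonnegative on the edges and hence on the whole of [X - g]. *)
Lemma edge_directions X : polytope X -> X !=set0 ->
  (forall E, edge X E -> exists u : 'rV[rat]_n, is_direction_space E <[map_mx ratr u]>) ->
  exists es : seq 'rV[int]_n, forall A, A \in unitmx ->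
    (forall e, e \in es -> uncut e A) -> subordinate (normal_fan X) A.
Proof.
move=> [_ /finite_seqP[V ->] ->]; rewrite convex_hull_seqE => X0 Xrat.
pose dir_spec (vv : 'rV[R]_n * 'rV[R]_n) e := exists c, vv.1 - vv.2 = c *: real_mx e.
pose dir vv := xget 0 [set e | dir_spec vv e].
exists [seq dir (v, v') | v <- V, v' <- V] => A uA Auncut.
have [w w0 winj] := generic_interior_form V uA.
pose phi := \sum_j w j *: col j (real_mx A).
have phiE x : pairing phi x = \sum_j w j * pairing (col j (real_mx A)) x.
  by rewrite /phi pairing_suml; apply: eq_bigr => j _; rewrite pairingZl.
have V0 : V != [::] by apply/eqP => V0; have [x] := X0; rewrite V0.
have [g gV gmin] : exists2 g, g \in V &
    forall v, v \in V -> v != g -> 0 < pairing phi (v - g).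
  have [v0 v0V] : exists v0, v0 \in V.
    by case: (V) V0 => // v0 ? _; exists v0; rewrite mem_head.
  have [//|i _ imin] := @arg_minP _ _ _ (SeqSub v0V : seq_sub V) xpredT
    (fun v => pairing phi (val v)).
  exists (val i) => [|v vV vi]; first exact: valP.
  rewrite lt_neqAle pairingBr subr_ge0 (imin (SeqSub vV))// andbT eq_sym.
  by apply: contra vi => /eqP h; apply/eqP/winj; rewrite ?(valP i)// -phiE pairingBr.
have [D [Dpos Dv Dedge XD]] := polytope_sub_edge_cone gV gmin.
have Dcol d j : d \in D -> 0 <= pairing (col j (real_mx A)) d.
  move=> dD; have [v vV dE] := Dv _ dD.
  have [E [edgeE Eg Egd]] := Dedge _ dD.
  have [e ee [c dc]] : exists2 e, e \in [seq dir (v, v') | v <- V, v' <- V] &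
      exists c, d = c *: real_mx e.
    exists (dir (v, g)); first by apply/allpairsP; exists (v, g).
    suff : dir_spec (v, g) (dir (v, g)) by rewrite /dir_spec/= -dE.
    have [u [u1 _]] := Xrat _ edgeE; have [e [c uE]] := rational_direction u.
    have /vlineP[b] := u1 _ _ Egd Eg.
    rewrite addrAC subrr add0r uE scalerA => bE.
    by apply: (@xgetPex _ 0 [set e | dir_spec (v, g) e]); exists e; exists (b * c); rewrite /= -dE.
  have dA i : pairing (col i (real_mx A)) d = c * ((e *m A) 0 i)%:~R.
    by rewrite pairing_col dc -scalemxAl mxE -map_mxM mxE.
  have eA := Auncut e ee.
  (* the weighted sum of the values is positive, hence so is one of them *)
  have [i ci] : exists i, 0 < c * ((e *m A) 0 i)%:~R.
    apply: contrapT => /forallNP h; have := Dpos _ dD; rewrite phiE ltNge => /negP; apply.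
    apply: sumr_le0 => k _; rewrite dA mulr_ge0_le0 ?(ltW (w0 k))// leNgt.
    exact/negP/h.
  rewrite dA; have [c0|c0|c0] := ltgtP c 0; last by move: ci; rewrite c0 mul0r ltxx.
    move: ci; rewrite nmulr_rgt0// ltrz0 => ci.
    rewrite nmulr_rge0// lerz0 leNgt; apply/negP => /(eA j i).
    by rewrite leNgt ci.
  move: ci; rewrite pmulr_rgt0// ltr0z => /(eA i j).
  by rewrite pmulr_rge0// ler0z.
pose F := hull_seq V `&` [set x | pairing (- phi) x = pairing (- phi) g].
have Fg x : F x -> x = g.
  move=> [hx /=]; rewrite !pairing_simp => /oppr_inj xg.
  have phix : pairing phi (x - g) = 0 by rewrite pairingBr xg subrr.
  have := XD _ hx; have [->|xNg] := eqVneq x g; first by [].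
  move=> /(@cone_ray _ _ _ phi 0)[||//|c /eqP].
  - by rewrite pairing0r.
  - by move=> d dD _; exact: Dpos.
  - by rewrite scaler0 subr_eq0 => /eqP.
exists (normal_cone (hull_seq V) F).
  exists F => //; split; last by exists g; split => //; exact: mem_hull_seq.
  exists (- phi), (pairing (- phi) g); split => // x hx /=.
  rewrite !pairing_simp lerN2 -subr_ge0 -pairingBr.
  by apply: pairing_cone_ge0 (XD _ hx) => d /Dpos/ltW.
move=> j p q /Fg -> hq; rewrite pairingNl -pairingNr opprB.
by apply: pairing_cone_ge0 (XD _ hq) => d dD; exact: Dcol.
Qed.

End EdgeDirections.

(** * Complete smooth projective fans and star subdivisions *)

Section SmoothFans.
Context {R : realType} {n : nat}.
Implicit Types (x : 'rV[R]_n) (a u v w : 'cV[int]_n) (A : 'M[int]_n) (e : 'rV[int]_n).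

Local Notation real_mx := (map_mx (intr : int -> R)).
Local Notation height a x := (pairing (real_mx a) x).

(** A complete smooth fan given by its maximal cones: the columns of [A k] are
    the ray generators of the cone of index [k]. The points [q k] are the
    vertices of a polytope with that inner normal fan: [fan_min] and
    [fan_strict] say that a ray attains its minimum over the points [q l] at
    those with a cone that contains the ray, and only there. Several indices
    may carry the same cone. *)
Record smooth_fan (T : finType) (A : T -> 'M[int]_n) (q : T -> 'rV[R]_n) : Prop :=
    SmoothFan {
  fan_unit : forall k, A k \in unitmx;
  fan_complete : forall beta : 'cV[R]_n, exists k,
    forall i, 0 <= (real_mx (invmx (A k)) *m beta) i 0;
  fan_min : forall k l j, height (col j (A k)) (q k) <= height (col j (A k)) (q l);
  fan_strict : forall k l j, height (col j (A k)) (q l) = height (col j (A k)) (q k) ->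
    exists i, col i (A l) = col j (A k)
}.

Lemma height_col A x j : height (col j A) x = (x *m real_mx A) 0 j.
Proof. by rewrite map_col pairing_col. Qed.

Lemma heightD u v x : height (u + v) x = height u x + height v x.
Proof. by rewrite map_mxD pairingDl. Qed.

Lemma height_dual A i j : A \in unitmx ->
  height (col i A) (row j (real_mx (invmx A))) = (i == j)%:R.
Proof. by move=> uA; rewrite height_col -row_mul unit_real_mxVK// !mxE eq_sym. Qed.

Lemma unitmx_col_inj A i j : A \in unitmx -> col i A = col j A -> i = j.
Proof.
move=> uA /(congr1 (fun a => height a (row i (real_mx (invmx A))))).
rewrite !height_dual// eqxx; case: eqP => [//|_] /eqP.
by rewrite oner_eq0.
Qed.

Lemma small_positive_scale (I : finType) (c d : I -> R) :
  exists2 eps, 0 < eps & forall i, 0 < c i -> 0 < c i + eps * d i.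
Proof.
pose s := 1 + \sum_i `|d i| / `|c i|.
have s_ge i : `|d i| / `|c i| < s.
  rewrite /s (bigD1 i)//= addrCA; apply: (@lt_le_trans _ _ (`|d i| / `|c i| + 1)).
    by rewrite ltrDl.
  by rewrite lerD2l lerDl sumr_ge0// => j _; rewrite divr_ge0.
have s0 : 0 < s by rewrite ltr_pwDl// sumr_ge0// => j _; rewrite divr_ge0.
exists s^-1; first by rewrite invr_gt0.
move=> i ci; have := s_ge i; rewrite (gtr0_norm ci) ltr_pdivrMr// => h.
rewrite -(pmulr_rgt0 _ s0) mulrDr mulrA divff ?gt_eqF// mul1r.
have := ler_norm (- d i); rewrite normrN; lra.
Qed.

Definition add_col A i j := A *m (1%:M + delta_mx i j).

Lemma col_add_col A i j m :
  col m (add_col A i j) = if m == j then col i A + col j A else col m A.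
Proof.
rewrite /add_col mulmxDr mulmx1; apply/colP => r; rewrite !mxE.
rewrite (bigD1 i)//= big1 ?addr0; last first.
  by move=> k ki; rewrite !mxE (negPf ki) mulr0.
rewrite !mxE eqxx/=; case: eqP => [->|_]; rewrite ?mxE ?mulr1 ?mulr0 ?addr0//.
by rewrite addrC.
Qed.

Lemma add_col_inv A i j : i != j -> A \in unitmx ->
  add_col A i j \in unitmx /\
  invmx (add_col A i j) = (1%:M - delta_mx i j) *m invmx A.
Proof.
move=> ij uA.
have h : ((1%:M - delta_mx i j) *m invmx A) *m add_col A i j = 1%:M.
  rewrite /add_col mulmxA mulmxKV// mulmxDr mulmx1 mulmxBl mul1mx.
  by rewrite mul_delta_mx_0 1?eq_sym// subr0 subrK.
have [uP _] := mulmx1_unit (mulmx1C h).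
by split => //; rewrite -[RHS](mulmxK uP) h mul1mx.
Qed.

Section StarSubdivision.
Context (T : finType) (A : T -> 'M[int]_n) (q : T -> 'rV[R]_n).
Context (u v : 'cV[int]_n) (eps : R).

(** Star subdivision along the cone spanned by [u] and [v]: a maximal cone that
    contains both is split along [u + v] into two cones, told apart by a
    boolean. A cone that does not contain both is kept, twice. *)
Definition star_cell k :=
  [pick ij : 'I_n * 'I_n | (col ij.1 (A k) == u) && (col ij.2 (A k) == v)].

Definition star_rays (kb : T * bool) :=
  if star_cell kb.1 is Some ij then
    if kb.2 then add_col (A kb.1) ij.1 ij.2 else add_col (A kb.1) ij.2 ij.1
  else A kb.1.

(** The vertices of the polytope obtained by cutting off, at distance [eps],
    the face where [u] and [v] are both minimal. *)
Definition star_points (kb : T * bool) :=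
  if star_cell kb.1 is Some ij then
    q kb.1 + eps *: row (if kb.2 then ij.2 else ij.1) (real_mx (invmx (A kb.1)))
  else q kb.1.

Inductive star_spec k : 'M[int]_n -> 'rV[R]_n -> Prop :=
| StarKept of (forall i j, col i (A k) = u -> col j (A k) = v -> False) :
    star_spec k (A k) (q k)
| StarSplit i j of col i (A k) = u /\ col j (A k) = v \/
                   col i (A k) = v /\ col j (A k) = u :
    star_spec k (add_col (A k) i j) (q k + eps *: row j (real_mx (invmx (A k)))).

Lemma starP kb : star_spec kb.1 (star_rays kb) (star_points kb).
Proof.
rewrite /star_rays /star_points /star_cell.
case: pickP => [[i j] /andP[/= /eqP iu /eqP jv]|h].
  by case: kb.2; apply: StarSplit; [left|right].
apply: StarKept => i j iu jv.
by have := h (i, j); rewrite /= iu jv !eqxx.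
Qed.

Hypotheses (fanA : smooth_fan A q) (uNv : u != v) (eps0 : 0 < eps).

Hypothesis eps_rays : forall k l j m,
  height (col j (A k)) (q k) < height (col j (A k)) (q l) ->
  height (col j (A k)) (q k) < height (col j (A k)) (q l)
    + eps * height (col j (A k)) (row m (real_mx (invmx (A l)))).

Hypothesis eps_sum : forall k l,
  height (u + v) (q k) < height (u + v) (q l) ->
  height (u + v) (q k) + eps < height (u + v) (q l).

Let split_neq k i j : col i (A k) = u /\ col j (A k) = v \/
  col i (A k) = v /\ col j (A k) = u -> i != j.
Proof. by move=> h; apply: contra uNv => /eqP ij; case: h => -[<- <-]; rewrite ij. Qed.

Let split_sum k i j : col i (A k) = u /\ col j (A k) = v \/
  col i (A k) = v /\ col j (A k) = u -> col i (A k) + col j (A k) = u + v.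
Proof. by case=> -[-> ->]//; rewrite addrC. Qed.

Let shift k i j : height (col i (A k)) (q k + eps *: row j (real_mx (invmx (A k)))) =
  height (col i (A k)) (q k) + eps * (i == j)%:R.
Proof. by rewrite pairingDr pairingZr height_dual// (fan_unit fanA). Qed.

Let shift_sum k i j : col i (A k) = u /\ col j (A k) = v \/
  col i (A k) = v /\ col j (A k) = u ->
  height (u + v) (q k + eps *: row j (real_mx (invmx (A k)))) = height (u + v) (q k) + eps.
Proof.
move=> h; rewrite -(split_sum h) heightD !shift (negPf (split_neq h)) eqxx.
by rewrite mulr0 addr0 mulr1 addrA -heightD.
Qed.

(* The vertex of a split cone is displaced along the dual vector of the ray that
   it loses: the height of this ray increases, those of the other rays of the
   cone do not change. *)
Let old_ray k m lb :
  height (col m (A k)) (q k) <= height (col m (A k)) (star_points lb) /\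
  (height (col m (A k)) (star_points lb) = height (col m (A k)) (q k) ->
    exists i, col i (star_rays lb) = col m (A k)).
Proof.
have := fan_min fanA k lb.1 m; rewrite le_eqVlt => /predU1P[qkl|qkl].
  have [i im] := fan_strict fanA (esym qkl).
  case: starP => [_|i0 j0 h]; first by split; [rewrite qkl|exists i].
  rewrite qkl -im shift; split; first by rewrite lerDl mulr_ge0// ltW.
  move=> /eqP; rewrite -subr_eq0 addrAC subrr add0r mulf_eq0 gt_eqF//= pnatr_eq0.
  rewrite eqb0 => ij0; exists i.
  by rewrite col_add_col (negPf ij0).
suff : height (col m (A k)) (q k) < height (col m (A k)) (star_points lb).
  by move=> h; split; [exact: ltW|move=> hE; move: h; rewrite hE ltxx].
case: starP => [//|i0 j0 _].
by rewrite pairingDr pairingZr; exact: eps_rays.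
Qed.

(* The height of [u + v] increases by [eps] at the vertices of the face that is
   cut off, and it was larger than that already at the other ones. *)
Let new_ray k lb i j : col i (A k) = u -> col j (A k) = v ->
  height (u + v) (q k) + eps <= height (u + v) (star_points lb) /\
  (height (u + v) (star_points lb) = height (u + v) (q k) + eps ->
    exists m, col m (star_rays lb) = u + v).
Proof.
move=> iu jv.
have minu := fan_min fanA k lb.1 i; have minv := fan_min fanA k lb.1 j.
rewrite iu in minu; rewrite jv in minv.
case: starP => [nuv|i0 j0 h].
  have [|hle] := ltP (height (u + v) (q k)) (height (u + v) (q lb.1)).
    by move=> /eps_sum h; split; [exact: ltW|move=> hE; move: h; rewrite hE ltxx].
  exfalso; rewrite !heightD in hle.
  have [|i1 i1u] := @fan_strict _ _ _ fanA k lb.1 i; first by rewrite iu; lra.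
  have [|j1 j1v] := @fan_strict _ _ _ fanA k lb.1 j; first by rewrite jv; lra.
  by apply: (nuv i1 j1); rewrite ?i1u ?j1v.
have := fan_min fanA lb.1 k i0; have := fan_min fanA lb.1 k j0.
move=> minj0 mini0.
have hE : height (u + v) (q lb.1) = height (u + v) (q k).
  by rewrite !heightD; case: h => -[iE jE]; move: mini0 minj0; rewrite iE jE; lra.
rewrite (shift_sum h) hE; split => // _.
by rewrite -(split_sum h); exists j0; rewrite col_add_col eqxx.
Qed.

Lemma star_smooth_fan : smooth_fan star_rays star_points.
Proof.
have key kb lb j :
    height (col j (star_rays kb)) (star_points kb) <=
      height (col j (star_rays kb)) (star_points lb) /\
    (height (col j (star_rays kb)) (star_points lb) =
      height (col j (star_rays kb)) (star_points kb) ->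
     exists i, col i (star_rays lb) = col j (star_rays kb)).
  case: (starP kb) => [_|i0 j0 h]; first exact: old_ray.
  rewrite col_add_col; case: eqVneq => [_|jj0].
    rewrite (split_sum h) (shift_sum h).
    by case: h => -[iE jE]; [apply: (new_ray _ iE jE)|apply: (new_ray _ jE iE)].
  by rewrite shift (negPf jj0) mulr0 addr0; exact: old_ray.
split; last 2 first.
- by move=> kb lb j; have [] := key kb lb j.
- by move=> kb lb j; have [] := key kb lb j.
- move=> kb; case: starP => [_|i j h]; first exact: (fan_unit fanA).
  by have [] := add_col_inv (split_neq h) (fan_unit fanA kb.1).
move=> beta; have [k hk] := fan_complete fanA beta.
case hcell : (star_cell k) => [[i j]|]; last first.
  by exists (k, true); rewrite /star_rays /= hcell.
have [iu jv] : col i (A k) = u /\ col j (A k) = v.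
  move: hcell; rewrite /star_cell; case: pickP => //= ij /andP[/eqP iu /eqP jv] [ijE].
  by rewrite ijE in iu jv.
have ij : i != j by apply: (@split_neq k); left.
(* the coefficients of [beta] on [u] and [v] decide on which side it lies *)
have side i0 j0 : i0 != j0 ->
    (real_mx (invmx (A k)) *m beta) j0 0 <= (real_mx (invmx (A k)) *m beta) i0 0 ->
    forall m, 0 <= (real_mx (invmx (add_col (A k) i0 j0)) *m beta) m 0.
  move=> ij0 le0 m; have [_ ->] := add_col_inv ij0 (fan_unit fanA k).
  rewrite map_mxM -mulmxA map_mxB map_mx1 map_delta_mx mulmxBl mul1mx.
  move: (real_mx (invmx (A k)) *m beta) hk le0 => c c0 le0; rewrite !mxE.
  rewrite (bigD1 j0)//= big1 ?addr0; last first.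
    by move=> r rj; rewrite !mxE (negPf rj) andbF mul0r.
  rewrite !mxE eqxx andbT; case: eqP => [->|_]; last by rewrite mul0r subr0.
  by rewrite mul1r subr_ge0.
have [le|/ltW le] := leP ((real_mx (invmx (A k)) *m beta) j 0)
  ((real_mx (invmx (A k)) *m beta) i 0).
  by exists (k, true); rewrite /star_rays /= hcell /=; exact: side.
by exists (k, false); rewrite /star_rays /= hcell /=; apply: side => //; rewrite eq_sym.
Qed.

End StarSubdivision.
End SmoothFans.

(** * Refining a fan until no cone is cut *)

Section Resolution.
Context {R : realType} {n : nat}.
Implicit Types (u v x y : 'cV[int]_n) (A : 'M[int]_n) (e : 'rV[int]_n).

Local Notation real_mx := (map_mx (intr : int -> R)).
Local Notation height a x := (pairing (real_mx a) x).

Lemma star_exists (T : finType) (A : T -> 'M[int]_n) (q : T -> 'rV[R]_n) u v :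
  smooth_fan A q -> u != v ->
  exists q' : T * bool -> 'rV[R]_n, smooth_fan (star_rays A u v) q'.
Proof.
move=> fanA uNv.
pose c (x : (T * T * 'I_n * 'I_n) + (T * T)) := match x with
  | inl (k, l, j, _) => height (col j (A k)) (q l) - height (col j (A k)) (q k)
  | inr (k, l) => height (u + v) (q l) - height (u + v) (q k) end.
pose d (x : (T * T * 'I_n * 'I_n) + (T * T)) := match x with
  | inl (k, l, j, m) => height (col j (A k)) (row m (real_mx (invmx (A l))))
  | inr _ => -1 end.
have [eps eps0 small] := small_positive_scale c d.
exists (star_points A q u v eps); apply: star_smooth_fan => //.
  move=> k l j m; have := small (inl (k, l, j, m)); rewrite /c /d; lra.
by move=> k l; have := small (inr (k, l)); rewrite /c /d; lra.
Qed.

Definition slope e x : int := (e *m x) 0 0.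

Lemma slope_col e A j : (e *m A) 0 j = slope e (col j A).
Proof. by rewrite /slope colE mulmxA -colE [RHS]mxE. Qed.

Lemma slopeD e x y : slope e (x + y) = slope e x + slope e y.
Proof. by rewrite /slope mulmxDr mxE. Qed.

Definition cut_pair e A x y := exists i j,
  [/\ col i A = x, col j A = y, 0 < slope e x & slope e y < 0].

Lemma uncutP e A : uncut e A <-> forall x y, ~ cut_pair e A x y.
Proof.
split=> [h x y [i [j [<- <-]]]|h i j].
  by rewrite -!slope_col => /(h i j); rewrite leNgt => /negP.
rewrite !slope_col leNgt => xi; apply/negP => xj.
by apply: (h (col i A) (col j A)); exists i, j.
Qed.

Lemma star_uncut (T : finType) (A : T -> 'M[int]_n) u v e :
  (forall k, uncut e (A k)) -> forall kb, uncut e (star_rays A u v kb).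
Proof.
move=> Auncut kb; have := Auncut kb.1; have q (k : T) : 'rV[R]_n := 0.
case: (@starP R n T A q u v 0 kb) => [//|i j _ Ak a b].
rewrite !slope_col !col_add_col.
have {}Ak a' b' : 0 < slope e (col a' (A kb.1)) -> 0 <= slope e (col b' (A kb.1)).
  by rewrite -!slope_col; exact: Ak.
have all_ge0 :
    0 < slope e (if a == j then col i (A kb.1) + col j (A kb.1) else col a (A kb.1)) ->
    forall m, 0 <= slope e (col m (A kb.1)).
  case: ifP => _; last by move=> ha m; exact: Ak ha.
  rewrite slopeD => hs m.
  have [hi|hi] := ltP 0 (slope e (col i (A kb.1))); first exact: Ak hi.
  by apply: (Ak j); lia.
by move=> /all_ge0 h; case: ifP => _; rewrite ?slopeD ?addr_ge0.
Qed.

(** The slopes of [u + v] lie strictly between those of [u] and [v], so a pair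
    with the new ray has a smaller gap than some pair present before. *)
Lemma star_cut_pair (T : finType) (A : T -> 'M[int]_n) u v e (M : int) :
  (forall k, A k \in unitmx) ->
  (forall k x y, cut_pair e (A k) x y -> slope e x - slope e y <= M) ->
  0 < slope e u -> slope e v < 0 ->
  forall kb x y, cut_pair e (star_rays A u v kb) x y ->
    (cut_pair e (A kb.1) x y /\ (x, y) <> (u, v)) \/ slope e x - slope e y < M.
Proof.
move=> uA bound u0 v0 kb x y; have := bound kb.1; have q (k : T) : 'rV[R]_n := 0.
case: (@starP R n T A q u v 0 kb) => [nuv|i j h] {}bound [a [b [ax bY x0 y0]]].
  left; split; first by exists a, b.
  by case=> xu yv; apply: (nuv a b); rewrite ?ax ?bY ?xu ?yv.
have [ku [kv [hu hv]]] : exists ku kv, col ku (A kb.1) = u /\ col kv (A kb.1) = v.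
  by case: h => -[h1 h2]; [exists i, j|exists j, i].
have sum : col i (A kb.1) + col j (A kb.1) = u + v.
  by case: h => -[-> ->]//; rewrite addrC.
move: ax bY; rewrite !col_add_col sum.
case: eqVneq => [_|aj]; case: eqVneq => [_|bj] ax bY.
- by move: x0 y0; rewrite -ax -bY; lia.
- have : cut_pair e (A kb.1) u y by exists ku, b.
  by move=> /bound; rewrite -ax slopeD; right; lia.
- have : cut_pair e (A kb.1) x v by exists a, kv.
  by move=> /bound; rewrite -bY slopeD; right; lia.
- left; split; first by exists a, b.
  case=> xu yv; case: h => -[h1 h2].
    by case/eqP: bj; apply: (@unitmx_col_inj R _ _ _ _ (uA kb.1)); rewrite bY yv.
  by case/eqP: aj; apply: (@unitmx_col_inj R _ _ _ _ (uA kb.1)); rewrite ax xu.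
Qed.

Definition resolved (es : seq 'rV[int]_n) (good : 'M[int]_n -> Prop) :=
  exists (T : finType) (A : T -> 'M[int]_n) (q : T -> 'rV[R]_n),
    [/\ smooth_fan A q, forall e, e \in es -> forall k, uncut e (A k) &
        forall k, good (A k)].

(** Induction on a list [L] that contains all the pairs of maximal gap [M]: a star
    subdivision along its head removes this pair and creates no pair of gap [M]. *)
Lemma lower_gap es e (M : int) (L : seq ('cV[int]_n * 'cV[int]_n)) :
  resolved es (fun A => forall x y, cut_pair e A x y ->
    slope e x - slope e y <= M /\ (slope e x - slope e y = M -> (x, y) \in L)) ->
  resolved es (fun A => forall x y, cut_pair e A x y -> slope e x - slope e y < M).
Proof.
elim: L => [|[u v] L IH] [T [A [q [fanA unc gap]]]].
  exists T, A, q; split => // k x y /gap[le_gap eq_gap].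
  by rewrite lt_neqAle le_gap andbT; apply/eqP => /eq_gap.
apply: IH.
have [/andP[u0 v0]|uv0] := boolP ((0 < slope e u) && (slope e v < 0)); last first.
  exists T, A, q; split => // k x y xy; have [? eq_gap] := gap k x y xy.
  split=> // /eq_gap; rewrite in_cons => /predU1P[[xu yv]|//].
  by case: xy uv0 => i [j [_ _ x0 y0]]; rewrite -xu -yv x0 y0.
have [|q' fanA'] := star_exists fanA (_ : u != v).
  by apply/eqP => uv; move: u0 v0; rewrite uv; lia.
exists _, (star_rays A u v), q'; split => //.
  by move=> e' /unc; exact: star_uncut.
move=> kb x y xy.
have bound k x' y' : cut_pair e (A k) x' y' -> slope e x' - slope e y' <= M.
  by move=> /gap[].
have [[old xyNuv]|lt_gap] := star_cut_pair (fan_unit fanA) bound u0 v0 xy.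
  have [? eq_gap] := gap _ _ _ old; split=> // /eq_gap.
  by rewrite in_cons => /predU1P[/xyNuv|].
by split; [exact: ltW|move=> E; move: lt_gap; rewrite E ltxx].
Qed.

Lemma resolve_cons es e : resolved es (fun=> True) -> resolved (e :: es) (fun=> True).
Proof.
move=> h; suff [T [A [q [fanA unc gap]]]] :
    resolved es (fun A => forall x y, cut_pair e A x y -> slope e x - slope e y <= 0%:Z).
  exists T, A, q; split => // e'; rewrite in_cons => /predU1P[->|/unc//] k.
  by apply/uncutP => x y xy; have := gap _ _ _ xy; case: xy => i [j [_ _]]; lia.
have [M] : exists M : nat,
    resolved es (fun A => forall x y, cut_pair e A x y -> slope e x - slope e y <= M%:Z).
  have [T [A [q [fanA unc _]]]] := h.
  pose gap (kij : T * 'I_n * 'I_n) :=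
    `|slope e (col kij.1.2 (A kij.1.1)) - slope e (col kij.2 (A kij.1.1))|%N.
  exists (\sum_kij gap kij)%N, T, A, q; split=> // k x y [i [j [ix jy _ _]]].
  apply: (@le_trans _ _ (gap (k, i, j))%:Z); first by rewrite /gap/= ix jy; lia.
  by rewrite lez_nat (bigD1 (k, i, j))//= leq_addr.
elim: M => [//|M IH] [T [A [q [fanA unc gap]]]]; apply: IH.
have [|T' [A' [q' [fanA' unc' gap']]]] := @lower_gap es e M.+1%:Z
    [seq (col kij.1.2 (A kij.1.1), col kij.2 (A kij.1.1)) |
      kij <- enum {: T * 'I_n * 'I_n}].
  exists T, A, q; split => // k x y xy; split; first exact: gap xy.
  move=> _; case: xy => i [j [<- <- _ _]]; apply/mapP; exists (k, i, j) => //.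
  by rewrite mem_enum.
by exists T', A', q'; split => // k x y /gap'; lia.
Qed.

Lemma cube_resolved : resolved [::] (fun=> True).
Proof.
pose sg (s : {ffun 'I_n -> bool}) i : int := if s i then 1 else -1.
pose D s := diag_mx (\row_i sg s i).
have DD s : D s *m D s = 1%:M.
  apply/matrixP => i j; rewrite mul_diag_mx !mxE.
  by case: eqVneq => [->|_]; rewrite ?mulr1n ?mulr0n ?mulr0// /sg; case: ifP.
have uD s : D s \in unitmx by have [] := mulmx1_unit (DD s).
have invD s : invmx (D s) = D s.
  by rewrite -[RHS](mulmxK (uD s)) DD mul1mx.
have height_D s j (x : 'rV[R]_n) : height (col j (D s)) x = (sg s j)%:~R * x 0 j.
  by rewrite height_col /D map_diag_mx mul_mx_diag !mxE mulrC.
exists {ffun 'I_n -> bool}, D, (fun s => - real_mx (\row_i sg s i)); split => //.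
split => //.
- move=> beta; exists [ffun i => 0 <= beta i 0] => i.
  rewrite invD /D map_diag_mx mul_diag_mx !mxE /sg ffunE.
  by case: (leP 0 (beta i 0)) => [h|/ltW h]; rewrite /= ?mulrN1z ?mulN1r ?mul1r ?oppr_ge0.
- move=> k l j; rewrite !height_D !mxE /sg.
  by case: (k j); case: (l j); rewrite /= ?mulrN1z; lra.
- move=> k l j; rewrite !height_D !mxE => h; exists j.
  have klj : k j = l j.
    by move: h; rewrite /sg; case: (k j); case: (l j) => //=; rewrite ?mulrN1z; lra.
  apply/colP => i; rewrite !mxE /sg; case: eqVneq => [->|_].
    by rewrite klj.
  by rewrite !mulr0n.
Qed.

Lemma resolution es : resolved es (fun=> True).
Proof. by elim: es => [|e es IH]; [exact: cube_resolved|exact: resolve_cons]. Qed.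

End Resolution.

(** * A criterion for Delzant polytopes *)

Section FanRays.
Context {R : realType} {n : nat}.
Implicit Types (x : 'rV[R]_n) (A : 'M[int]_n).

Local Notation real_mx := (map_mx (intr : int -> R)).
Local Notation height a x := (pairing (real_mx a) x).

Lemma point_in_dual_basis A x : A \in unitmx ->
  x = \sum_j height (col j A) x *: row j (real_mx (invmx A)).
Proof.
move=> uA; under eq_bigr do rewrite height_col.
by rewrite -mulmx_sum_row -mulmxA unit_real_mxK// mulmx1.
Qed.

Lemma pairing_in_basis A (beta : 'cV[R]_n) x : A \in unitmx ->
  pairing beta x = \sum_j (real_mx (invmx A) *m beta) j 0 * height (col j A) x.
Proof.
move=> uA; under eq_bigr do rewrite height_col mulrC.
by rewrite -[X in pairing _ X]mulmx1 -(unit_real_mxK uA) /pairing mulmxA -mulmxA mxE.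
Qed.

(** The vertex at the other end of an edge is the one where a form just beyond
    the facet opposite to that edge, in the normal cone, attains its minimum. *)
Lemma smooth_fan_neighbour (T : finType) (A : T -> 'M[int]_n) (q : T -> 'rV[R]_n) k i :
  smooth_fan A q ->
  exists l, exists2 t, 0 < t & q l = q k + t *: row i (real_mx (invmx (A k))).
Proof.
move=> fanA; have uA := fan_unit fanA.
pose ht j x := height (col j (A k)) x.
pose c l := \sum_(j | j != i) (ht j (q l) - ht j (q k)).
pose d l := ht i (q k) - ht i (q l).
have [delta delta0 small] := small_positive_scale c d.
pose beta := \sum_(j | j != i) real_mx (col j (A k)) - delta *: real_mx (col i (A k)).
have betaE x : pairing beta x = \sum_(j | j != i) ht j x - delta * ht i x.
  rewrite /beta pairingDl pairingNl pairingZl; congr (_ - _).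
  by rewrite /pairing mulmx_sumr summxE.
have [l hl] := fan_complete fanA beta.
have le_beta : pairing beta (q l) <= pairing beta (q k).
  rewrite !(pairing_in_basis _ _ (uA l)); apply: ler_sum => m _.
  by apply: ler_wpM2l => //; exact: (fan_min fanA).
have min_k j : 0 <= ht j (q l) - ht j (q k) by rewrite subr_ge0; exact: (fan_min fanA).
have c0 : c l = 0.
  apply/eqP; rewrite eq_le sumr_ge0// andbT leNgt; apply/negP => /small.
  by move: le_beta; rewrite !betaE /c /d sumrB; lra.
have ht_eq j : j != i -> ht j (q l) = ht j (q k).
  move/eqP: c0; rewrite psumr_eq0// => /allP/(_ j); rewrite mem_index_enum => /(_ isT).
  by move=> /implyP h /h; rewrite subr_eq0 => /eqP.
exists l, (ht i (q l) - ht i (q k)); last first.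
  rewrite [LHS](point_in_dual_basis _ (uA k)) [X in _ = X + _](point_in_dual_basis _ (uA k)).
  rewrite [LHS](bigD1 i)//= [in RHS](bigD1 i)//= addrAC -scalerDl addrC -/(ht i (q l)).
  rewrite -/(ht i (q k)) [ht i (q k) + _]addrC subrK addrC; congr (_ + _).
  by apply: eq_bigr => j ji; rewrite -/(ht j _) ht_eq.
rewrite lt_neqAle min_k andbT eq_sym; apply/eqP => /eqP; rewrite subr_eq0 => /eqP hti.
(* otherwise both cones are the same, and [beta] lies outside of it *)
have col_l j : exists m, col m (A l) = col j (A k).
  by apply: (fan_strict fanA); have [->//|/ht_eq] := eqVneq j i.
have [m mi] := col_l i; have := hl m.
have -> : (real_mx (invmx (A l)) *m beta) m 0 = pairing beta (row m (real_mx (invmx (A l)))).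
  by rewrite /pairing -row_mul [RHS]mxE.
rewrite betaE big1 => [|j ji]; rewrite /ht.
  by rewrite -mi height_dual// eqxx mulr1; lra.
have [m' mj] := col_l j; rewrite -mj height_dual//; case: eqP => // mm'.
by move/eqP: ji; case; apply: (@unitmx_col_inj R _ _ _ _ (uA k)); rewrite -mj mm' mi.
Qed.

End FanRays.

Section DelzantCriterion.
Context {R : realType} {n : nat}.

Local Notation real_mx := (map_mx (intr : int -> R)).
Local Notation height a x := (pairing (real_mx a) x).

Variables (T : finType) (A : T -> 'M[int]_n) (x : T -> 'rV[R]_n) (X : set 'rV[R]_n).
Hypothesis uA : forall k, A k \in unitmx.
Hypothesis complete : forall beta : 'cV[R]_n, exists k,
  forall i, 0 <= (real_mx (invmx (A k)) *m beta) i 0.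
Hypothesis Xconvex : convex_set (X : set (convex_lmodType 'rV[R]_n)).
Hypothesis Xx : forall k, X (x k).
Hypothesis xmin : forall k j y, X y -> height (col j (A k)) (x k) <= height (col j (A k)) y.

Let dir k i : 'rV[R]_n := row i (real_mx (invmx (A k))).

Hypothesis Xdir : forall k i, exists2 t, 0 < t & X (x k + t *: dir k i).

Implicit Types (y : 'rV[R]_n) (F E : set 'rV[R]_n).

Let ht k j y := height (col j (A k)) y.

Let ht_dir k i j : ht k i (dir k j) = (i == j)%:R.
Proof. exact: height_dual. Qed.

Let ht_move k i j t : ht k i (x k + t *: dir k j) = ht k i (x k) + t * (i == j)%:R.
Proof. by rewrite /ht pairingDr pairingZr -/(ht k i (dir k j)) ht_dir. Qed.

Let dir_neq0 k i : dir k i != 0.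
Proof.
apply/eqP => d0; have := ht_dir k i i; rewrite d0 /ht pairing0r eqxx => /eqP.
by rewrite eq_sym oner_eq0.
Qed.

Let minimiser beta : exists k, forall y, X y -> pairing beta (x k) <= pairing beta y.
Proof.
have [k hk] := complete beta; exists k => y Xy.
rewrite !(pairing_in_basis _ _ (uA k)); apply: ler_sum => j _.
by apply: ler_wpM2l => //; exact: xmin.
Qed.

Let X_polytope : polytope X.
Proof.
exists [set` codom x]; first exact: finite_seq.
rewrite convex_hull_seqE; apply/seteqP; split; last first.
  by apply: hull_sub_convex => // _ /codomP[k ->].
move=> y Xy; apply: contrapT => /hull_separation[beta hbeta].
have [k /(_ _ Xy)] := minimiser beta.
by have := hbeta _ (codom_f x k); rewrite pairingBr; lra.
Qed.

Let X_full : has_dimension X n.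
Proof.
have [k _] := complete 0; split; first by exists (x k).
exists fullv; last by rewrite dimvf /dim /= mul1n.
split=> [y z _ _|W WX]; first by rewrite memvf.
apply/subvP => y _; rewrite [y](point_in_dual_basis _ (uA k)).
apply: memv_suml => j _; apply: memvZ.
have [t t0 Xt] := Xdir k j; have := WX _ _ Xt (Xx k).
by rewrite addrAC subrr add0r => /(memvZ t^-1); rewrite scalerA mulVf ?scale1r// gt_eqF.
Qed.

Let facet_line k i := X `&` [set y | forall j, j != i -> ht k j y = ht k j (x k)].

Let line_coord k i y : facet_line k i y ->
  y = x k + (ht k i y - ht k i (x k)) *: dir k i.
Proof.
move=> [_ hy]; rewrite [LHS](point_in_dual_basis _ (uA k)).
rewrite [X in _ = X + _](point_in_dual_basis _ (uA k)).
rewrite [LHS](bigD1 i)//= [in RHS](bigD1 i)//= addrAC -scalerDl addrC.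
rewrite -/(ht k i y) -/(ht k i (x k)) [ht k i (x k) + _]addrC subrK addrC; congr (_ + _).
by apply: eq_bigr => j ji; rewrite -/(ht k j _) hy.
Qed.

Let line_vertex k i : facet_line k i (x k).
Proof. by split. Qed.

Let line_point k i : exists2 t, 0 < t & facet_line k i (x k + t *: dir k i).
Proof.
have [t t0 Xt] := Xdir k i; exists t => //; split => // j ji.
by rewrite ht_move (negPf ji) mulr0 addr0.
Qed.

Let line_diff k i y z : facet_line k i y -> facet_line k i z ->
  exists c, y - z = c *: dir k i.
Proof.
move=> /line_coord yE /line_coord zE; exists (ht k i y - ht k i z).
by rewrite {1}yE {1}zE opprD addrACA subrr add0r -scalerBl opprB addrA subrK.
Qed.

Let line_edge k i : edge X (facet_line k i).
Proof.
have [t t0 Lt] := line_point k i.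
apply: (@edge_of_line _ _ _ _ (t *: dir k i)).
- pose alpha := - \sum_(j | j != i) real_mx (col j (A k)).
  have alphaE y : pairing alpha y = - \sum_(j | j != i) ht k j y.
    by rewrite /alpha pairingNl /pairing mulmx_sumr summxE.
  exists alpha, (pairing alpha (x k)); split.
    by move=> y Xy /=; rewrite !alphaE lerN2; apply: ler_sum => j _; exact: xmin.
  apply/seteqP; split=> y [Xy hy]; split => //=.
    by rewrite !alphaE; congr (- _); apply: eq_bigr => j /hy.
  move: hy; rewrite /= !alphaE => /oppr_inj/eqP; rewrite -subr_eq0 -sumrB.
  rewrite psumr_eq0 => [/allP h j ji|j _]; last by rewrite subr_ge0; exact: xmin.
  have := h j; rewrite mem_index_enum ji subr_eq0 => /(_ isT)/eqP.
  by [].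
- by rewrite scaler_eq0 negb_or gt_eqF// dir_neq0.
- by exists (x k), (x k + t *: dir k i); split.
- move=> y z Ly Lz; have [c cE] := line_diff Ly Lz; exists (c / t).
  by rewrite scalerA divfK ?gt_eqF.
Qed.

Let face_vertex F : face X F -> F !=set0 -> exists k, F (x k).
Proof.
move=> [alpha [c [Xc ->]]] [y [Xy /= yc]].
have [k /(_ _ Xy)] := minimiser (- alpha); rewrite !pairingNl lerN2 yc => ck.
by exists k; split => //=; apply/eqP; rewrite eq_le ck andbT; exact: Xc.
Qed.

(* The facets that contain the face are those opposite to the directions along
   which its defining form decreases. *)
Let face_at F k : face X F -> F (x k) -> exists I : pred 'I_n,
  forall y, F y <-> X y /\ forall i, I i -> ht k i y = ht k i (x k).
Proof.
move=> [alpha [c [Xc ->]]] [_ /= kc].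
have alphaE y : pairing alpha y = c + \sum_i (ht k i y - ht k i (x k)) * pairing alpha (dir k i).
  rewrite -{1}kc -[LHS](subrKC (pairing alpha (x k))) -pairingBr; congr (_ + _).
  rewrite {1}[y - x k](point_in_dual_basis _ (uA k)) /pairing mulmx_suml summxE.
  apply: eq_bigr => j _; rewrite -!/(pairing _ _) pairingZr pairingBr.
  by [].
have dir_le0 i : pairing alpha (dir k i) <= 0.
  have [t t0 /Xc] := Xdir k i; rewrite /= pairingDr pairingZr kc gerDl.
  by rewrite pmulr_rle0.
exists (fun i => pairing alpha (dir k i) != 0) => y; split=> -[Xy /= hy]; split => //=.
  move=> i ai; move: hy; rewrite alphaE => /eqP; rewrite -subr_eq0 addrAC subrr add0r.
  rewrite -oppr_eq0 -sumrN psumr_eq0 => [/allP/(_ i)|j _]; last first.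
    by rewrite -mulrN mulr_ge0 ?oppr_ge0// subr_ge0; exact: xmin.
  by rewrite mem_index_enum oppr_eq0 mulf_eq0 (negPf ai) orbF subr_eq0 => /(_ isT)/eqP.
rewrite alphaE big1 ?addr0// => i _.
by have [->|/hy->] := eqVneq (pairing alpha (dir k i)) 0; rewrite ?mulr0// subrr mul0r.
Qed.

Let edge_at E k : edge X E -> E (x k) -> exists i, E = facet_line k i.
Proof.
move=> [fE [_ [U [UE Umin] dimU]]] Ek; have [I EI] := face_at fE Ek.
have dirU i : ~~ I i -> dir k i \in U.
  move=> Ii; have [t t0 Xt] := Xdir k i.
  have : E (x k + t *: dir k i).
    apply/EI; split => // j Ij; rewrite ht_move; case: eqVneq => [ji|_].
      by rewrite ji (negPf Ii) in Ij.
    by rewrite mulr0 addr0.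
  move=> /UE/(_ Ek); rewrite addrAC subrr add0r => /(memvZ t^-1).
  by rewrite scalerA mulVf ?scale1r// gt_eqF.
have [i Ii] : exists i, ~~ I i.
  apply: contrapT => /forallNP noI.
  have Esing y : E y -> y = x k.
    move=> /EI[_ hy]; rewrite [LHS](point_in_dual_basis _ (uA k)).
    rewrite [RHS](point_in_dual_basis _ (uA k)); apply: eq_bigr => j _.
    by rewrite -!/(ht k j _) hy//; apply/negPn/negP; exact: noI.
  have /dimvS : (U <= 0)%VS.
    by apply: Umin => y z /Esing-> /Esing->; rewrite subrr mem0v.
  by rewrite dimU dimv0.
have UE' : U = <[dir k i]>%VS.
  by apply/esym/eqP; rewrite eqEdim -memvE dirU//= dimU dim_vline dir_neq0.
exists i; apply/seteqP; split=> y.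
  move=> /EI[Xy hy]; split => // j ji; apply: hy; apply: contraT => /dirU.
  rewrite UE' => /vlineP[c dc]; have := ht_dir k j j; rewrite dc /ht pairingZr.
  by rewrite -/(ht k j (dir k i)) ht_dir (negPf ji) eqxx mulr0 => /eqP; rewrite eq_sym oner_eq0.
move=> [Xy hy]; apply/EI; split => // j Ij; apply: hy.
by apply: contraTneq Ij => ->.
Qed.

Let line_inj k : injective (facet_line k).
Proof.
move=> i j ij; have [t t0] := line_point k i; rewrite ij => -[_ /(_ i)].
case: (eqVneq i j) => // _ /(_ isT); rewrite ht_move eqxx mulr1 => /eqP.
by rewrite -subr_eq0 addrAC subrr add0r gt_eqF.
Qed.

Let vertex_index v : vertex X v -> exists k, v = x k.
Proof. by move=> /face_vertex[]; [exists v|move=> k <-; exists k]. Qed.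

Let primitive_row (B C : 'M[int]_n) i : B *m C = 1%:M -> primitive (row i B).
Proof.
move=> BC; rewrite /primitive; set g := \big[gcdz/0]_j _.
have gdvd j : (g %| B i j)%Z.
  have -> : B i j = row i B 0 j by rewrite mxE.
  rewrite /g; have := mem_index_enum j; elim: (index_enum _) => // l s IH.
  rewrite in_cons big_cons => /predU1P[<-|/IH]; first exact: dvdz_gcdl.
  by apply: dvdz_trans; exact: dvdz_gcdr.
have g1 : (g %| 1)%Z.
  suff : (g %| (B *m C) i i)%Z by rewrite BC mxE eqxx.
  by rewrite mxE; apply: rpred_sum => j _; exact: dvdz_mulr.
have g0 : 0 <= g.
  by rewrite /g; elim/big_rec: _ => // j y _ _; rewrite /gcdz.
by move: g1 g0; rewrite dvdz1; case: g {gdvd} => // m /eqP /= ->.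
Qed.

(** By completeness every form attains its minimum over [X] at some [x k]; with
    separation, this makes [X] the hull of these points and puts one of them on
    each nonempty face. A face through [x k] is determined by the facets through
    [x k] on which it lies, so the edges at [x k] are exactly the [n] lines along
    the lattice basis dual to the columns of [A k]. *)
Lemma delzant_criterion : delzant_polytope X.
Proof.
split => //.
- move=> _ /vertex_index[k ->].
  have -> : [set E | edge X E /\ E (x k)] = facet_line k @` [set: 'I_n].
    apply/seteqP; split=> [E [eE Ek]|_ [i _ <-]]; last by split.
    by have [i ->] := edge_at eE Ek; exists i.
  apply: (card_eq_trans (inj_card_eq _)); first by move=> i j _ _; exact: line_inj.
  by rewrite card_eq_sym; exact: card_II.
- move=> E eE; have [k Ek] := face_vertex eE.1 eE.2.1.
  have [i ->] := edge_at eE Ek.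
  exists (row i (map_mx intr (invmx (A k)))).
  have -> : map_mx ratr (row i (map_mx intr (invmx (A k)))) = dir k i.
    by apply/rowP => j; rewrite !mxE ratr_int.
  have [t t0 Lt] := line_point k i.
  suff -> : <[dir k i]>%VS = <[t *: dir k i]>%VS.
    apply: is_direction_line.
    + by rewrite scaler_eq0 negb_or gt_eqF// dir_neq0.
    + by exists (x k), (x k + t *: dir k i); split.
    + move=> y z Ly Lz; have [c cE] := line_diff Ly Lz; exists (c / t).
      by rewrite scalerA divfK ?gt_eqF.
  by apply/esym/eqP; rewrite eqEdim -memvE memvZ ?memv_line//= !dim_vline scaler_eq0 gt_eqF.
- move=> _ /vertex_index[k ->]; exists (invmx (A k)).
    move=> z; exists (z *m A k); split; first by rewrite mulmxK.
    by move=> c ->; rewrite mulmxKV.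
  apply/seteqP; split=> [_ [i _ <-]|u [uprim [E [eE Ek [t t0 Et]]]]].
    split; first by apply: primitive_row (mulVmx (uA k)).
    exists (facet_line k i); split; [exact: line_edge|exact: line_vertex|].
    by have [t t0 Lt] := line_point k i; exists t; rewrite // map_row.
  have [i Ei] := edge_at eE Ek; rewrite Ei in Et.
  have ht_u j : ht k j (x k + t *: real_mx u) = ht k j (x k) + t * ((u *m A k) 0 j)%:~R.
    by rewrite /ht pairingDr pairingZr (height_col _ (real_mx u)) -map_mxM [in LHS]mxE.
  have uj j : j != i -> (u *m A k) 0 j = 0.
    move=> ji; have := Et.2 j ji; rewrite ht_u => /eqP; rewrite -subr_eq0 addrAC subrr add0r.
    by rewrite mulf_eq0 gt_eqF//= intr_eq0 => /eqP.
  set m : int := (u *m A k) 0 i.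
  have m0 : 0 <= m.
    by have := @xmin k i _ Et.1; rewrite -/(ht k i _) -/(ht k i _) ht_u lerDl pmulr_rge0// ler0z.
  have uE : u = m *: row i (invmx (A k)).
    rewrite -[LHS](mulmxK (uA k)) mulmx_sum_row (bigD1 i)//= big1 ?addr0// => j /uj->.
    by rewrite scale0r.
  have : (m %| 1)%Z.
    suff : (m %| \big[gcdz/0]_i u 0%R i)%Z by rewrite uprim.
    elim/big_rec: _ => [|j y _ my]; first exact: dvdz0.
    by rewrite dvdz_gcd my uE mxE dvdz_mulr.
  rewrite dvdz1 => /eqP m1; exists i => //.
  by rewrite uE (_ : m = 1) ?scale1r//; move: m0 m1; case: (m) => // ? _ /= ->.
Qed.

End DelzantCriterion.

(** * Weighted Minkowski sums *)

Section HausdorffBounds.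
Context {R : realType} {n : nat}.
Implicit Types (x y : 'rV[R]_n) (X Y : set 'rV[R]_n).

Lemma euclid_normZ c x : euclid_norm (c *: x) = `|c| * euclid_norm x.
Proof.
rewrite /euclid_norm -sqrtr_sqr -sqrtrM ?sqr_ge0// mulr_sumr; congr Num.sqrt.
by apply: eq_bigr => i _; rewrite mxE exprMn.
Qed.

Lemma hausdorff_dist_le X Y r : X !=set0 -> Y !=set0 ->
  (forall x, X x -> exists2 y, Y y & euclid_dist x y <= r) ->
  (forall y, Y y -> exists2 x, X x & euclid_dist y x <= r) ->
  hausdorff_dist X Y <= r.
Proof.
have half X1 Y1 : X1 !=set0 -> (forall x, X1 x -> exists2 y, Y1 y & euclid_dist x y <= r) ->
    sup [set point_set_dist x Y1 | x in X1] <= r.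
  move=> [x X1x] h; apply: ge_sup; first by exists (point_set_dist x Y1), x.
  move=> _ [z X1z <-]; have [y Y1y zy] := h _ X1z.
  exact: le_trans (point_set_dist_le _ Y1y) zy.
by move=> X0 Y0 hX hY; rewrite /hausdorff_dist ge_max !half.
Qed.

Lemma hausdorff_dist_lt X Y r : euclid_bounded X -> Y !=set0 ->
  hausdorff_dist X Y < r -> forall x, X x -> exists2 y, Y y & euclid_dist x y < r.
Proof.
move=> bX Y0; rewrite /hausdorff_dist gt_max => /andP[h _] x Xx.
have d0 : 0 < r - point_set_dist x Y.
  by rewrite subr_gt0; apply: le_lt_trans h; exact: point_set_dist_le_excess.
have [y Yy] := point_set_dist_adherent x Y0 d0.
by rewrite subrKC; exists y.
Qed.

End HausdorffBounds.

Section Blend.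
Context {R : realType} {n : nat}.
Implicit Types (x y z : 'rV[R]_n) (X Y Z : set 'rV[R]_n) (a b c r M : R).

Local Notation is_convex X := (convex_set (X : set (convex_lmodType 'rV[R]_n))).
Local Notation real_mx := (map_mx (intr : int -> R)).

Definition blend a b c X Y Z : set 'rV[R]_n :=
  [set w | exists x y z, [/\ X x, Y y, Z z & w = a *: x + b *: y + c *: z]].

Lemma blend_convex a b c X Y Z : is_convex X -> is_convex Y -> is_convex Z ->
  is_convex (blend a b c X Y Z).
Proof.
move=> /convex_setP cX /convex_setP cY /convex_setP cZ; apply/convex_setP.
move=> _ _ t t01 [x [y [z [Xx Yy Zz ->]]]] [x' [y' [z' [Xx' Yy' Zz' ->]]]].
exists (t *: x + (1 - t) *: x'), (t *: y + (1 - t) *: y'), (t *: z + (1 - t) *: z').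
by split; [exact: cX|exact: cY|exact: cZ|apply/rowP => i; rewrite !mxE; ring].
Qed.

Lemma subordinate_vertex X (A : 'M[int]_n) : subordinate (normal_fan X) A ->
  exists2 x, X x & forall y j, X y ->
    pairing (real_mx (col j A)) x <= pairing (real_mx (col j A)) y.
Proof.
move=> [_ [F [[alpha [c [_ FE]]] [x Fx]] <-] NA].
exists x; first by move: Fx; rewrite FE => -[].
move=> y j Xy; have := NA j x y Fx Xy.
by rewrite pairingNl pairingBr opprB subr_ge0 map_col.
Qed.

(** For each maximal cone the three minimisers add up to a minimiser over the sum,
    and a step along an edge of the last summand is a step inside the sum. *)
Lemma blend_delzant (T : finType) (A : T -> 'M[int]_n) (q : T -> 'rV[R]_n) a b c X Y :
  smooth_fan A q -> is_convex X -> is_convex Y ->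
  (forall k, subordinate (normal_fan X) (A k)) ->
  (forall k, subordinate (normal_fan Y) (A k)) ->
  0 <= a -> 0 <= b -> 0 < c ->
  delzant_polytope (blend a b c X Y (hull_seq (codom q))).
Proof.
move=> fanA cX cY subX subY a0 b0 c0.
have /choice[f fP] : forall k, exists x, X x /\ forall y j, X y ->
    pairing (real_mx (col j (A k))) x <= pairing (real_mx (col j (A k))) y.
  by move=> k; have [x ? ?] := subordinate_vertex (subX k); exists x.
have /choice[g gP] : forall k, exists x, Y x /\ forall y j, Y y ->
    pairing (real_mx (col j (A k))) x <= pairing (real_mx (col j (A k))) y.
  by move=> k; have [x ? ?] := subordinate_vertex (subY k); exists x.
have hq k : hull_seq (codom q) (q k) by apply: mem_hull_seq; exact: codom_f.
apply: (@delzant_criterion _ _ _ A (fun k => a *: f k + b *: g k + c *: q k)).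
- exact: (fan_unit fanA).
- exact: (fan_complete fanA).
- by apply: blend_convex => //; exact: convex_hull_seq.
- by move=> k; exists (f k), (g k), (q k); split; [exact: (fP k).1|exact: (gP k).1| |].
- move=> k j _ [x [y [z [Xx Yy Zz ->]]]]; rewrite !pairing_simp.
  apply: lerD; first apply: lerD.
  + by apply: ler_wpM2l => //; exact: (fP k).2.
  + by apply: ler_wpM2l => //; exact: (gP k).2.
  + apply: ler_wpM2l; first exact: ltW.
    apply: (hull_sub_convex (convex_halfspace (alpha := real_mx (col j (A k))) (c := _)) _ Zz).
    by move=> _ /codomP[l ->]; exact: (fan_min fanA).
- move=> k i; have [l [t t0 qlE]] := smooth_fan_neighbour k i fanA.
  exists (c * t); first exact: mulr_gt0.
  exists (f k), (g k), (q l); split; [exact: (fP k).1|exact: (gP k).1|exact: hq|].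
  by rewrite qlE scalerDr scalerA !addrA.
Qed.

Lemma blend_nonempty a b c X Y Z : X !=set0 -> Y !=set0 -> Z !=set0 ->
  blend a b c X Y Z !=set0.
Proof.
by move=> [x ?] [y ?] [z ?]; exists (a *: x + b *: y + c *: z), x, y, z.
Qed.

Lemma blend_dist a b c a' b' c' x y z x' M :
  euclid_norm x' <= M -> euclid_norm y <= M -> euclid_norm z <= M ->
  euclid_dist (a *: x + b *: y + c *: z) (a' *: x' + b' *: y + c' *: z) <=
  `|a| * euclid_dist x x' + (`|a - a'| + `|b - b'| + `|c - c'|) * M.
Proof.
move=> xM yM zM; rewrite /euclid_dist.
have -> : a *: x + b *: y + c *: z - (a' *: x' + b' *: y + c' *: z) =
    a *: (x - x') + ((a - a') *: x' + (b - b') *: y + (c - c') *: z).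
  by apply/rowP => i; rewrite !mxE; ring.
apply: (le_trans (euclid_normD _ _)); rewrite euclid_normZ lerD2l.
apply: (le_trans (euclid_normD _ _)); rewrite mulrDl; apply: lerD; last first.
  by rewrite euclid_normZ; apply: ler_wpM2l.
apply: (le_trans (euclid_normD _ _)); rewrite mulrDl !euclid_normZ.
by apply: lerD; apply: ler_wpM2l.
Qed.

Lemma blend_hausdorff a b c a' b' c' X X' Y Z M r :
  X !=set0 -> X' !=set0 -> Y !=set0 -> Z !=set0 ->
  euclid_bounded X ->
  (forall x, X' x -> euclid_norm x <= M) ->
  (forall x, Y x -> euclid_norm x <= M) ->
  (forall x, Z x -> euclid_norm x <= M) ->
  hausdorff_dist X X' < r ->
  hausdorff_dist (blend a b c X Y Z) (blend a' b' c' X' Y Z) <=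
  `|a| * r + (`|a - a'| + `|b - b'| + `|c - c'|) * M.
Proof.
move=> X0 X'0 Y0 Z0 bX X'M YM ZM hr.
have bound x x' y z : X' x' -> Y y -> Z z -> euclid_dist x x' <= r ->
    euclid_dist (a *: x + b *: y + c *: z) (a' *: x' + b' *: y + c' *: z) <=
    `|a| * r + (`|a - a'| + `|b - b'| + `|c - c'|) * M.
  move=> X'x' Yy Zz xx'.
  apply: (le_trans (blend_dist _ _ _ _ _ _ _ (X'M _ X'x') (YM _ Yy) (ZM _ Zz))).
  by rewrite lerD2r ler_wpM2l.
apply: hausdorff_dist_le; [exact: blend_nonempty|exact: blend_nonempty| |].
- move=> _ [x [y [z [Xx Yy Zz ->]]]].
  have [x' X'x' /ltW xx'] := hausdorff_dist_lt bX X'0 hr Xx.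
  by exists (a' *: x' + b' *: y + c' *: z); [exists x', y, z|exact: bound].
- move=> _ [x' [y [z [X'x' Yy Zz ->]]]]; rewrite hausdorff_distC in hr.
  have bX' : euclid_bounded X' by exists M.
  have [x Xx /ltW xx'] := hausdorff_dist_lt bX' X0 hr X'x'.
  exists (a *: x + b *: y + c *: z); first by exists x, y, z.
  by rewrite euclid_distC; apply: bound; rewrite // euclid_distC.
Qed.

Lemma blend_left X Y Z : Y !=set0 -> Z !=set0 -> blend 1 0 0 X Y Z = X.
Proof.
move=> [y Yy] [z Zz]; apply/seteqP; split=> [_ [x [y' [z' [Xx _ _ ->]]]]|x Xx].
  by rewrite scale1r !scale0r !addr0.
by exists x, y, z; split=> //; rewrite scale1r !scale0r !addr0.
Qed.

Lemma blend_right X Y Z : X !=set0 -> Z !=set0 -> blend 0 1 0 X Y Z = Y.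
Proof.
move=> [x Xx] [z Zz]; apply/seteqP; split=> [_ [x' [y [z' [_ Yy _ ->]]]]|y Yy].
  by rewrite scale1r !scale0r addr0 add0r.
by exists x, y, z; split=> //; rewrite scale1r !scale0r addr0 add0r.
Qed.

Lemma blend_same s X Z : is_convex X -> Z !=set0 -> 0 <= s <= 1 ->
  blend (1 - s) s 0 X X Z = X.
Proof.
move=> /convex_setP cX [z Zz] s01; apply/seteqP; split.
  move=> _ [x [y [z' [Xx Xy _ ->]]]]; rewrite scale0r addr0 addrC.
  exact: cX.
move=> x Xx; exists x, x, z; split=> //.
by rewrite scale0r addr0 -scalerDl subrK scale1r.
Qed.

End Blend.

(** * Contracting a loop of finite complexity *)

Section Contraction.
Context {R : realType} {n : nat}.
Implicit Types P : delzant R n.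

Lemma polytope_convex (X : set 'rV[R]_n) : polytope X ->
  convex_set (X : set (convex_lmodType 'rV[R]_n)).
Proof.
by move=> [_ /finite_seqP[s ->] ->]; rewrite convex_hull_seqE; exact: convex_hull_seq.
Qed.

(** Being subordinate is a property of the normal fan, so one list of hyperplanes
    per fan is enough. *)
Lemma common_refinement (I : Type) (P : I -> delzant R n) :
  finite_set (range (fun t => normal_fan (P t))) ->
  exists (T : finType) (A : T -> 'M[int]_n) (q : T -> 'rV[R]_n),
    smooth_fan A q /\ forall t k, subordinate (normal_fan (P t)) (A k).
Proof.
move=> /finite_seqP[fans fansE].
have /choice[es esP] : forall fan, exists es : seq 'rV[int]_n,
    range (fun t => normal_fan (P t)) fan -> forall A, A \in unitmx ->
    (forall e, e \in es -> uncut e A) -> subordinate fan A.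
  move=> fan; have [[t _ <-]|] := pselect (range (fun t => normal_fan (P t)) fan); last first.
    by exists [::].
  have DP := delzant_setP (P t).
  have [es hes] := edge_directions (delzant_is_polytope DP) (delzant_nonempty (P t))
    (delzant_rational DP).
  by exists es.
have [T [A [q [fanA unc _]]]] := @resolution R n (flatten [seq es fan | fan <- fans]).
exists T, A, q; split=> // t k.
have ft : range (fun t => normal_fan (P t)) (normal_fan (P t)) by exists t.
apply: (esP _ ft); first exact: (fan_unit fanA).
move=> e ee; apply: unc; apply/flattenP; exists (es (normal_fan (P t))) => //.
by apply: map_f; move: ft; rewrite fansE.
Qed.

Local Notation I := (unit_interval R).

Let coord (s : I) : R := val s.

Let coord_itv s : 0 <= coord s <= 1.
Proof. by have := set_valP s; rewrite /= in_itv. Qed.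

Let coord_cont : continuous coord.
Proof. exact: initial_continuous. Qed.

Variables (P : delzant R n) (gamma : {path I from P to P in delzant R n}).
Variables (T : finType) (A : T -> 'M[int]_n) (q : T -> 'rV[R]_n).
Hypothesis fanA : smooth_fan A q.
Hypothesis subA : forall t k, subordinate (normal_fan (gamma t)) (A k).

Let Q := hull_seq (codom q).

Let weight (p : I * I) : R := coord p.1 * (1 - coord p.1) * (coord p.2 * (1 - coord p.2)).

Let hom (p : I * I) : set 'rV[R]_n :=
  blend (1 - coord p.1) (coord p.1) (weight p) (gamma p.2) P Q.

Let Q0 : Q !=set0.
Proof.
have [k _] := fan_complete fanA 0; exists (q k).
by apply: mem_hull_seq; exact: codom_f.
Qed.

Let delzant_convex (D : delzant R n) : convex_set (D : set (convex_lmodType 'rV[R]_n)).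
Proof. exact/polytope_convex/delzant_is_polytope/delzant_setP. Qed.

Let hom_start t : hom (zero, t) = gamma t.
Proof.
rewrite /hom /weight /= (_ : coord zero = 0)// subr0 !mul0r.
by apply: blend_left => //; exact: delzant_nonempty.
Qed.

Let hom_end t : hom (one, t) = P.
Proof.
rewrite /hom /weight /= (_ : coord one = 1)// subrr mulr0 mul0r.
by apply: blend_right => //; exact: delzant_nonempty.
Qed.

Let hom_side s t : coord t * (1 - coord t) = 0 -> gamma t = P -> hom (s, t) = P.
Proof.
move=> t0 gt; rewrite /hom /weight /= t0 mulr0 gt.
by apply: blend_same; [exact: delzant_convex|exact: Q0|exact: coord_itv].
Qed.

Let coord_zero s : coord s = 0 -> s = zero.
Proof. by move=> s0; exact/val_inj. Qed.

Let coord_one s : coord s = 1 -> s = one.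
Proof. by move=> s1; exact/val_inj. Qed.

Let hom_delzant p : delzant_polytope (hom p).
Proof.
case: p => s t; have /andP[s0 s1] := coord_itv s; have /andP[t0 t1] := coord_itv t.
have [/coord_zero->|sN0] := eqVneq (coord s) 0; first by rewrite hom_start; exact: delzant_setP.
have [/coord_one->|sN1] := eqVneq (coord s) 1; first by rewrite hom_end; exact: delzant_setP.
have [/coord_zero->|tN0] := eqVneq (coord t) 0.
  rewrite hom_side ?path_zero//; first exact: delzant_setP.
  by rewrite (_ : coord zero = 0)// mul0r.
have [/coord_one->|tN1] := eqVneq (coord t) 1.
  rewrite hom_side ?path_one//; first exact: delzant_setP.
  by rewrite (_ : coord one = 1)// subrr mulr0.
apply: (@blend_delzant _ _ T A q); first exact: fanA.
- exact: delzant_convex.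
- exact: delzant_convex.
- exact: subA.
- by move=> k; rewrite -(path_zero (s := gamma)); exact: subA.
- by rewrite subr_ge0.
- exact: s0.
- by rewrite /weight /= !mulr_gt0// ?subr_gt0 lt_neqAle ?s0 ?t0 ?s1 ?t1 ?andbT//= eq_sym.
Qed.

Let H p : delzant R n := Delzant (hom_delzant p).

Let coef_gap (p0 p : I * I) : R :=
  `|(1 - coord p.1) - (1 - coord p0.1)| + `|coord p.1 - coord p0.1| + `|weight p - weight p0|.

Let coef_gap_cvg p0 : coef_gap p0 p @[p --> p0] --> 0.
Proof.
have FF : Filter (nbhs p0) := nbhs_filter p0.
have cs : coord p.1 @[p --> p0] --> coord p0.1.
  by apply: (cvg_comp _ coord cvg_fst); exact: coord_cont.
have ct : coord p.2 @[p --> p0] --> coord p0.2.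
  by apply: (cvg_comp _ coord cvg_snd); exact: coord_cont.
have cN (f : I * I -> R) (l : R) : f p @[p --> p0] --> l -> 1 - f p @[p --> p0] --> 1 - l.
  by move=> fl; apply: cvgB => //; exact: cvg_cst.
have cw : weight p @[p --> p0] --> weight p0.
  by apply: cvgM; [apply: cvgM => //; exact: cN|apply: cvgM => //; exact: cN].
have gap0 (f : I * I -> R) (l : R) : f p @[p --> p0] --> l -> `|f p - l| @[p --> p0] --> 0.
  move=> fl; rewrite -(normr0 R) -(subrr l); apply: cvg_norm.
  by apply: cvgB => //; exact: cvg_cst.
rewrite -[0]addr0 -[X in X + _]addr0.
by apply: cvgD; [apply: cvgD|]; apply: gap0 => //; exact: cN.
Qed.

Let H_continuous : continuous H.
Proof.
move=> p0; have FF : Filter (nbhs p0) := nbhs_filter p0.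
have [M1 hM1] := delzant_bounded (gamma p0.2).
have [M2 hM2] := delzant_bounded P.
have [M3 hM3] : euclid_bounded Q.
  apply/compact_euclid_bounded/polytope_compact.
  by exists [set` codom q]; rewrite ?convex_hull_seqE.
pose M := 1 + (`|M1| + `|M2| + `|M3|).
have M0 : 0 < M by rewrite /M; have := (normr_ge0 M1, normr_ge0 M2, normr_ge0 M3); case=> -[]; lra.
have [MM1 MM2 MM3] : [/\ M1 <= M, M2 <= M & M3 <= M].
  have := (ler_norm M1, ler_norm M2, ler_norm M3).
  have := (normr_ge0 M1, normr_ge0 M2, normr_ge0 M3).
  by rewrite /M; move=> [[? ?] ?] [[? ?] ?]; split; lra.
apply/cvg_ballP => e e0.
have e2 : 0 < e / 2 by rewrite divr_gt0.
have near_gamma : \forall p \near p0, ball (gamma p0.2) (e / 2) (gamma p.2).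
  have : gamma p.2 @[p --> p0] --> gamma p0.2.
    by apply: (cvg_comp _ gamma cvg_snd); exact: cts_fun.
  by move=> /cvg_ballP; apply.
have near_coef : \forall p \near p0, coef_gap p0 p < e / (2 * M).
  apply: (cvgr_lt 0 (coef_gap_cvg p0)).
  by rewrite divr_gt0// mulr_gt0.
near=> p.
have gp : ball (gamma p0.2) (e / 2) (gamma p.2) by near: p.
have cp : coef_gap p0 p < e / (2 * M) by near: p.
rewrite ballEmdist /= in gp; rewrite ballEmdist /=.
have {}gp : hausdorff_dist (gamma p.2) (gamma p0.2) < e / 2 by rewrite hausdorff_distC.
have hle := @blend_hausdorff _ _ (1 - coord p.1) (coord p.1) (weight p)
  (1 - coord p0.1) (coord p0.1) (weight p0) _ _ P Q M _ (delzant_nonempty _)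
  (delzant_nonempty _) (delzant_nonempty P) Q0 (delzant_bounded _)
  (fun x hx => le_trans (hM1 x hx) MM1) (fun x hx => le_trans (hM2 x hx) MM2)
  (fun x hx => le_trans (hM3 x hx) MM3) gp.
change (hausdorff_dist (hom p0) (hom p) < e); rewrite hausdorff_distC.
apply: (le_lt_trans hle).
have /andP[s0 s1] := coord_itv p.1.
have : coef_gap p0 p * M < e / 2.
  by move: cp; rewrite invfM mulrA ltr_pdivlMr.
have : `|1 - coord p.1| * (e / 2) <= e / 2.
  by rewrite ger0_norm ?subr_ge0// ler_piMl ?(ltW e2)// gerBl.
by rewrite -/(coef_gap p0 p) [e in _ < e]splitr; lra.
Unshelve. all: by end_near. Qed.

Lemma loop_contracts : null_homotopic gamma.
Proof.
exists H; first exact: H_continuous.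
split=> [t|t|s|s]; apply: delzant_inj => /=.
- exact: hom_start.
- exact: hom_end.
- by rewrite hom_side ?path_zero// (_ : coord zero = 0)// mul0r.
- by rewrite hom_side ?path_one// (_ : coord one = 1)// subrr mulr0.
Qed.

End Contraction.

Theorem corollary3p37 (R : realType) (n : nat) (P : delzant R n)
    (gamma : {path unit_interval R from P to P in delzant R n}) :
  finite_complexity gamma -> null_homotopic gamma.
Proof.
move=> /common_refinement[T [A [q [fanA subA]]]].
exact: loop_contracts fanA subA.
Qed.
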